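(* Let $E/\mathbb{Q}$ be an elliptic curve of Mordell--Weil rank $r$, $M_E=E(\mathbb{Q})/E(\mathbb{Q})_{\mathrm{tors}}$, and let $P_1,\dots,P_r$ be a basis $\mathcal{B}$ of $M_E$. For $P\in M_E$ let $\gamma_P(t)=tP+M_E$, $t\in[0,1]$, be the associated closed geodesic in the height torus $\mathcal{T}_E=V_E/M_E$. The $r(r+1)/2$ marked squared lengths $$\operatorname{Length}(\gamma_{P_i})^2\ (1\le i\le r),\qquad \operatorname{Length}(\gamma_{P_i+P_j})^2\ (1\le i<j\le r)$$ determine the complete Gram matrix $G_E(\mathcal{B})=(\langle P_i,P_j\rangle_E)_{i,j}$. Explicitly, $$\langle P_i,P_i\rangle_E=\operatorname{Length}(\gamma_{P_i})^2,$$ $$\langle P_i,P_j\rangle_E=\tfrac12\left(\operatorname{Length}(\gamma_{P_i+P_j})^2-\operatorname{Length}(\gamma_{P_i})^2-\operatorname{Length}(\gamma_{P_j})^2\right).$$ Consequently, the marked length data determine the regulator $\operatorname{Reg}(E/\mathbb{Q})$ and the metric isometry class of $\mathcal{T}_E$.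
   Context: For an elliptic curve $E/\mathbb{Q}$, $M_E:=E(\mathbb{Q})/E(\mathbb{Q})_{\mathrm{tors}}$ is free abelian of finite rank $r$. $\widehat h_E$ is the canonical (N\'eron--Tate) height in the Cremona/PARI normalization, i.e. $\widehat h_E(P)=\lim_{n\to\infty}4^{-n}h(x(2^nP))$ with $h$ the logarithmic Weil height on $\mathbb{P}^1(\mathbb{Q})$ (twice the height in Silverman's normalization). The pairing $\langle P,Q\rangle_E=\frac12(\widehat h_E(P+Q)-\widehat h_E(P)-\widehat h_E(Q))$ descends to $M_E$ and extends $\mathbb{R}$-bilinearly to a positive-definite inner product on $V_E:=M_E\otimes_{\mathbb{Z}}\mathbb{R}$. The height torus is $\mathcal{T}_E:=V_E/M_E$ with the quotient flat Riemannian metric (a point when $r=0$). The regulator is $\operatorname{Reg}(E/\mathbb{Q}):=\det G_E(\mathcal{B})$ for any basis $\mathcal{B}$ of $M_E$, with value $1$ when $r=0$. *)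

(* Defs.v *)
From HB Require Import structures.
From mathcomp Require Import all_boot all_order all_algebra.
From mathcomp Require Import ring_quotient generic_quotient freeg.
From mathcomp Require Import all_classical all_reals all_analysis.
From mathcomp Require Import ring.

Set Implicit Arguments.
Unset Strict Implicit.
Unset Printing Implicit Defensive.

Import Order.TTheory GRing.Theory Num.Theory.
Import numFieldNormedType.Exports.
Local Open Scope classical_set_scope.
Local Open Scope ring_scope.
Local Open Scope quotient_scope.

Definition weierstrass_disc (F : fieldType) (a1 a2 a3 a4 a6 : F) : F :=
  let b2 := a1 ^+ 2 + 4 * a2 in
  let b4 := 2 * a4 + a1 * a3 in
  let b6 := a3 ^+ 2 + 4 * a6 in
  let b8 := a1 ^+ 2 * a6 + 4 * a2 * a6 - a1 * a3 * a4 + a2 * a3 ^+ 2 - a4 ^+ 2 in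
  - b2 ^+ 2 * b8 - 8 * b4 ^+ 3 - 27 * b6 ^+ 2 + 9 * b2 * b4 * b6.

Record ellcurve (F : fieldType) := EllCurve {
  ec_a1 : F; ec_a2 : F; ec_a3 : F; ec_a4 : F; ec_a6 : F;
  ec_disc_neq0 : weierstrass_disc ec_a1 ec_a2 ec_a3 ec_a4 ec_a6 != 0
}.

(* Algebraic core of associativity for P = (x1, y1), Q = (x2, y2), R = (x3, y3):
   l and m are the slopes of PQ and QR, and d is the second divided difference of
   the ordinates (confluent if P = Q).  Once a2 is expressed through these, the
   slopes k of (P + Q)R and n of P(Q + R) are - l - a1 + 1/d and - m - a1 + 1/d. *)
Lemma ec_assoc_alg (F : fieldType) (a1 a2 a3 x1 x2 x3 y1 l d : F)
  (m := l + d * (x3 - x1)) (y2 := y1 + l * (x2 - x1)) (y3 := y2 + m * (x3 - x2))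
  (xS := l ^+ 2 + a1 * l - a2 - x1 - x2) (yS := - (y1 + l * (xS - x1)) - a1 * xS - a3)
  (xT := m ^+ 2 + a1 * m - a2 - x2 - x3) (yT := - (y2 + m * (xT - x2)) - a1 * xT - a3)
  (k := (yS - y3) / (xS - x3)) (n := (yT - y1) / (xT - x1))
  (xA := n ^+ 2 + a1 * n - a2 - x1 - xT) :
  a2 = y1 * d + l * m + d * y3 + a1 * (x1 * d + m) + a3 * d - (x1 + x2 + x3) ->
  xS != x3 -> xT != x1 ->
  xA = k ^+ 2 + a1 * k - a2 - x3 - xS /\
  y1 + n * (xA - x1) = y3 + k * (xA - x3).
Proof.
move=> a2E nS nT.
pose w := y1 + y3 + l * (x3 - x1) + a1 * x3 + a3.
pose z := y1 + y3 + m * (x1 - x3) + a1 * x1 + a3.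
have eS : xS - x3 = - (d * w) by rewrite /xS a2E /w /y3 /m; ring.
have eT : xT - x1 = - (d * z) by rewrite /xT a2E /z /y3 /m; ring.
have dw : d * w != 0 by rewrite -oppr_eq0 -eS subr_eq0.
have dz : d * z != 0 by rewrite -oppr_eq0 -eT subr_eq0.
have [d0 w0] : d != 0 /\ w != 0 by apply/andP; rewrite -negb_or -mulf_eq0.
have z0 : z != 0 by move: dz; rewrite mulf_eq0 negb_or => /andP[].
have eS' : xS = x3 - d * w by rewrite -eS; ring.
have eT' : xT = x1 - d * z by rewrite -eT; ring.
have kE : k = - l - a1 + (y3 + y1 + l * (x3 - x1) + a1 * x3 + a3) / (d * w).
  by rewrite /k eS /yS eS'; field; rewrite ?oppr_eq0 ?mulf_neq0 ?d0 ?w0.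
have nE : n = - m - a1 + (y1 + y3 + m * (x1 - x3) + a1 * x1 + a3) / (d * z).
  by rewrite /n eT /yT eT' /y3; field; rewrite ?oppr_eq0 ?mulf_neq0 ?d0 ?w0 ?z0.
have kE' : k = - l - a1 + d^-1.
  rewrite kE; congr (_ + _); rewrite (_ : y3 + y1 + _ + _ + _ = w); last by rewrite /w; ring.
  by field; rewrite ?oppr_eq0 ?mulf_neq0 ?d0 ?w0 ?z0.
have nE' : n = - m - a1 + d^-1.
  by rewrite nE; congr (_ + _); rewrite -/z; field; rewrite ?oppr_eq0 ?mulf_neq0 ?d0 ?w0 ?z0.
have xAE : xA = k ^+ 2 + a1 * k - a2 - x3 - xS.
  by rewrite /xA eS' eT' kE' nE' /w /z /m; field.
split=> //; rewrite xAE eS' kE' nE' a2E /w /y3 /y2 /m; field.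
by [].
Qed.

Section EllipticCurveGroup.
Variables (F : fieldType) (E : ellcurve F).
Local Notation a1 := (ec_a1 E).
Local Notation a2 := (ec_a2 E).
Local Notation a3 := (ec_a3 E).
Local Notation a4 := (ec_a4 E).
Local Notation a6 := (ec_a6 E).

(* [None] is the point at infinity *)
Definition ec_on_curve (p : option (F * F)) : bool :=
  if p is Some (x, y) then
    y ^+ 2 + a1 * x * y + a3 * y == x ^+ 3 + a2 * x ^+ 2 + a4 * x + a6
  else true.

Record ecpoint := Point { coords :> option (F * F); coordsP : ec_on_curve coords }.

HB.instance Definition _ := [isSub for coords].
HB.instance Definition _ := [Choice of ecpoint by <:].

Definition ec_opp_coords (p : option (F * F)) : option (F * F) :=
  if p is Some (x, y) then Some (x, - y - a1 * x - a3) else None.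

Definition ec_slope (x1 y1 x2 y2 : F) : F :=
  if x1 == x2 then
    (3 * x1 ^+ 2 + 2 * a2 * x1 + a4 - a1 * y1) / (2 * y1 + a1 * x1 + a3)
  else (y2 - y1) / (x2 - x1).

Definition ec_add_coords (p q : option (F * F)) : option (F * F) :=
  match p, q with
  | None, _ => q
  | _, None => p
  | Some (x1, y1), Some (x2, y2) =>
    if (x1 == x2) && (y1 == - y2 - a1 * x2 - a3) then None
    else
      let l := ec_slope x1 y1 x2 y2 in
      let x3 := l ^+ 2 + a1 * l - a2 - x1 - x2 in
      let y3 := y1 + l * (x3 - x1) in
      Some (x3, - y3 - a1 * x3 - a3)
  end.

(* [ec_line l v x1 x2 x3]: the cubic obtained by restricting the curve to the line
   y = l x + v has roots x1, x2, x3. *)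
Definition ec_line (l v x1 x2 x3 : F) : Prop :=
  [/\ x1 + x2 + x3 = l ^+ 2 + a1 * l - a2,
      x1 * x2 + x1 * x3 + x2 * x3 = a4 - 2 * l * v - a1 * v - a3 * l &
      x1 * x2 * x3 = v ^+ 2 + a3 * v - a6].

Lemma ec_line12 l v x1 x2 x3 : ec_line l v x1 x2 x3 -> ec_line l v x2 x1 x3.
Proof. by case=> e1 e2 e3; split; rewrite -?(e1, e2, e3); ring. Qed.

Lemma ec_line13 l v x1 x2 x3 : ec_line l v x1 x2 x3 -> ec_line l v x3 x2 x1.
Proof. by case=> e1 e2 e3; split; rewrite -?(e1, e2, e3); ring. Qed.

Lemma ec_line_opp l v x1 x2 x3 :
  ec_line l v x1 x2 x3 -> ec_line (- l - a1) (- v - a3) x1 x2 x3.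
Proof. by case=> e1 e2 e3; split; rewrite ?(e1, e2, e3); ring. Qed.

Lemma ec_line_on l v x1 x2 x3 :
  ec_line l v x1 x2 x3 -> ec_on_curve (Some (x1, l * x1 + v)).
Proof.
case=> e1 e2 e3 /=.
have -> : a6 = v ^+ 2 + a3 * v - x1 * x2 * x3 by rewrite e3; ring.
have -> : a4 = x1 * x2 + x1 * x3 + x2 * x3 + 2 * l * v + a1 * v + a3 * l.
  by rewrite e2; ring.
have -> : a2 = l ^+ 2 + a1 * l - (x1 + x2 + x3) by rewrite e1; ring.
by apply/eqP; ring.
Qed.

Lemma ec_nonsingular x y : ec_on_curve (Some (x, y)) -> 2 * y + a1 * x + a3 = 0 ->
  3 * x ^+ 2 + 2 * a2 * x + a4 - a1 * y = 0 -> False.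
Proof.
move=> /eqP eC eY eX; case/eqP: (ec_disc_neq0 E); rewrite /weierstrass_disc.
have -> : a6 = y ^+ 2 + a1 * x * y + a3 * y - (x ^+ 3 + a2 * x ^+ 2 + a4 * x).
  by rewrite eC; ring.
have -> : a3 = - (2 * y + a1 * x).
  by apply/eqP; rewrite -addr_eq0 addrC eY.
have -> : a4 = - (3 * x ^+ 2 + 2 * a2 * x - a1 * y).
  by apply/eqP; rewrite -addr_eq0 -eX; apply/eqP; ring.
by ring.
Qed.

Lemma ec_sum_line l v x1 x2 x3 : ec_line l v x1 x2 x3 ->
  ec_add_coords (Some (x1, l * x1 + v)) (Some (x2, l * x2 + v)) =
  ec_opp_coords (Some (x3, l * x3 + v)).
Proof.
move=> L /=; have oC := ec_line_on L; case: (L) => e1 e2 e3.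
have x3E : x3 = l ^+ 2 + a1 * l - a2 - x1 - x2 by rewrite -e1; ring.
suff [/negbTE -> ->] : ~~ ((x1 == x2) && (l * x1 + v == - (l * x2 + v) - a1 * x2 - a3))
    /\ ec_slope x1 (l * x1 + v) x2 (l * x2 + v) = l.
  by rewrite -x3E; do 2!congr pair || congr Some; ring.
rewrite /ec_slope; have [eqx|neqx] := eqVneq x1 x2; last first.
  by split=> //; field; rewrite subr_eq0 eq_sym.
move: L oC e1 e2 e3 x3E; rewrite -{x2}eqx => L oC e1 e2 e3 x3E.
have e : 3 * x1 ^+ 2 + 2 * a2 * x1 + a4 - a1 * (l * x1 + v) =
         l * (2 * (l * x1 + v) + a1 * x1 + a3).
  have -> : a4 = x1 * x1 + x1 * x3 + x1 * x3 + 2 * l * v + a1 * v + a3 * l.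
    by rewrite e2; ring.
  by rewrite x3E; ring.
have u0 : 2 * (l * x1 + v) + a1 * x1 + a3 != 0.
  by apply/eqP => u0; apply: (ec_nonsingular oC u0); rewrite e u0 mulr0.
split; last by rewrite e mulfK.
apply: contraNneq u0 => /eqP/= h; rewrite -subr_eq0 in h.
by rewrite -(eqP h); apply/eqP; ring.
Qed.

Lemma ec_same_x x y y' : ec_on_curve (Some (x, y)) -> ec_on_curve (Some (x, y')) ->
  y = y' \/ y = - y' - a1 * x - a3.
Proof.
move=> /eqP/= h1 /eqP/= h2.
have /eqP : (y - y') * (y - (- y' - a1 * x - a3)) = 0.
  by transitivity (y ^+ 2 + a1 * x * y + a3 * y - (y' ^+ 2 + a1 * x * y' + a3 * y'));
    [ring | rewrite h1 h2 subrr].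
by rewrite mulf_eq0 !subr_eq0 => /orP[] /eqP ->; [left|right].
Qed.

Lemma ec_lineP x1 y1 x2 y2 : ec_on_curve (Some (x1, y1)) -> ec_on_curve (Some (x2, y2)) ->
  ~~ ((x1 == x2) && (y1 == - y2 - a1 * x2 - a3)) ->
  exists l v x3, [/\ ec_line l v x1 x2 x3, y1 = l * x1 + v & y2 = l * x2 + v].
Proof.
move=> h1 h2; have [eqx|neqx] /= := eqVneq x1 x2; last first.
  move=> _; pose l := (y2 - y1) / (x2 - x1).
  pose v := y1 - l * x1; pose x3 := l ^+ 2 + a1 * l - a2 - x1 - x2.
  have d : x2 - x1 != 0 by rewrite subr_eq0 eq_sym.
  have lE : l * (x2 - x1) = y2 - y1 by rewrite divfK.
  have y1E : y1 = l * x1 + v by rewrite /v; ring.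
  have y2E : y2 = l * x2 + v.
    by rewrite /v -[y2](subrK y1) -lE; ring.
  clearbody v => {lE}; clearbody l.
  exists l, v, x3; split=> //; split; first by rewrite /x3; ring.
  - apply: (mulfI d); move: h1 h2 => /eqP/= h1 /eqP/= h2.
    apply/eqP; rewrite -subr_eq0; apply/eqP.
    transitivity ((y2 ^+ 2 + a1 * x2 * y2 + a3 * y2)
       - (x2 ^+ 3 + a2 * x2 ^+ 2 + a4 * x2 + a6) - ((y1 ^+ 2 + a1 * x1 * y1 + a3 * y1)
       - (x1 ^+ 3 + a2 * x1 ^+ 2 + a4 * x1 + a6))); last by rewrite h1 h2; ring.
    by rewrite y1E y2E /x3; ring.
  - apply: (mulfI d); move: h1 h2 => /eqP/= h1 /eqP/= h2.
    apply/eqP; rewrite -subr_eq0; apply/eqP.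
    transitivity (x1 * ((y2 ^+ 2 + a1 * x2 * y2 + a3 * y2)
       - (x2 ^+ 3 + a2 * x2 ^+ 2 + a4 * x2 + a6)) - x2 * ((y1 ^+ 2 + a1 * x1 * y1 + a3 * y1)
       - (x1 ^+ 3 + a2 * x1 ^+ 2 + a4 * x1 + a6))); last by rewrite h1 h2; ring.
    by rewrite y1E y2E /x3; ring.
rewrite -{x2}eqx in h2 *; case: (ec_same_x h1 h2) => [<-|->]; last by rewrite eqxx.
move=> u.
have u0 : 2 * y1 + a1 * x1 + a3 != 0.
  by apply: contraNneq u => h; rewrite -subr_eq0 -h; apply/eqP; ring.
pose l := (3 * x1 ^+ 2 + 2 * a2 * x1 + a4 - a1 * y1) / (2 * y1 + a1 * x1 + a3).
have lE : l * (2 * y1 + a1 * x1 + a3) = 3 * x1 ^+ 2 + 2 * a2 * x1 + a4 - a1 * y1.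
  by rewrite divfK.
have a4E : a4 = l * (2 * y1 + a1 * x1 + a3) - (3 * x1 ^+ 2 + 2 * a2 * x1 - a1 * y1).
  by rewrite lE; ring.
have a6E : a6 = y1 ^+ 2 + a1 * x1 * y1 + a3 * y1 - (x1 ^+ 3 + a2 * x1 ^+ 2 + a4 * x1).
  by rewrite (eqP h1); ring.
exists l, (y1 - l * x1), (l ^+ 2 + a1 * l - a2 - x1 - x1); split; try ring.
split; first by ring.
- by rewrite a4E; move: (l) => *; ring.
- by rewrite a6E a4E; move: (l) => *; ring.
Qed.

Lemma ec_opp_on p : ec_on_curve p -> ec_on_curve (ec_opp_coords p).
Proof.
case: p => [[x y]|] //= /eqP h; apply/eqP; rewrite -h; ring.
Qed.

Lemma ec_add_on p q : ec_on_curve p -> ec_on_curve q -> ec_on_curve (ec_add_coords p q).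
Proof.
case: p q => [[x1 y1]|] [[x2 y2]|] // h1 h2.
case e: ((x1 == x2) && (y1 == - y2 - a1 * x2 - a3)); first by rewrite /= e.
have [l [v [x3 [L y1E y2E]]]] := ec_lineP h1 h2 (negbT e).
rewrite y1E y2E (ec_sum_line L); apply: ec_opp_on; exact: ec_line_on (ec_line13 L).
Qed.

Definition ec_zero_point : ecpoint := Point (isT : ec_on_curve None).
Definition ec_opp_point (P : ecpoint) : ecpoint := Point (ec_opp_on (coordsP P)).
Definition ec_add_point (P Q : ecpoint) : ecpoint := Point (ec_add_on (coordsP P) (coordsP Q)).

Local Notation "0" := ec_zero_point.
Local Notation "- P" := (ec_opp_point P).
Local Notation "P + Q" := (ec_add_point P Q).

Lemma ec_val_add P Q : val (P + Q) = ec_add_coords (val P) (val Q). Proof. by []. Qed.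
Lemma ec_val_opp P : val (- P) = ec_opp_coords (val P). Proof. by []. Qed.

Lemma ec_add0p : left_id 0 ec_add_point.
Proof. by move=> P; apply: val_inj. Qed.

Lemma ec_addp0 : right_id 0 ec_add_point.
Proof. by move=> P; apply: val_inj; case: P => [[[]|]]. Qed.

Lemma ec_oppK : involutive ec_opp_point.
Proof.
by case=> [[[x y]|] h]; apply: val_inj => //=; congr (Some (_, _)); ring.
Qed.

Lemma ec_addNp : left_inverse 0 ec_opp_point ec_add_point.
Proof. by case=> [[[x y]|] h]; apply: val_inj => //=; rewrite !eqxx. Qed.

Lemma ec_addpN : right_inverse 0 ec_opp_point ec_add_point.
Proof. by move=> P; rewrite -{1}(ec_oppK P) ec_addNp. Qed.

Lemma ec_opp0 : - 0 = 0. Proof. exact: val_inj. Qed.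

Lemma ec_add_case (P Q : ecpoint) :
  [\/ P = 0, Q = 0, P = - Q |
   exists x1 x2 x3 l v, [/\ ec_line l v x1 x2 x3, val P = Some (x1, l * x1 + v)%R
     & val Q = Some (x2, l * x2 + v)%R]].
Proof.
case: P Q => [[[x1 y1]|] h1] [[[x2 y2]|] h2].
- case e: ((x1 == x2) && (y1 == - y2 - a1 * x2 - a3)%R).
    by constructor 3; case/andP: e => /eqP e1 /eqP e2; apply: val_inj; rewrite /= e2 e1.
  have [l [v [x3 [L y1E y2E]]]] := ec_lineP h1 h2 (negbT e).
  by constructor 4; exists x1, x2, x3, l, v; rewrite /= -y1E -y2E.
- by constructor 2; apply: val_inj.
- by constructor 1; apply: val_inj.
- by constructor 1; apply: val_inj.
Qed.

Lemma ec_addpC : commutative ec_add_point.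
Proof.
move=> P Q; case: (ec_add_case P Q) => [->|->|->|].
- by rewrite ec_add0p ec_addp0.
- by rewrite ec_add0p ec_addp0.
- by rewrite ec_addNp ec_addpN.
- move=> [x1 [x2 [x3 [l [v [L p q]]]]]]; apply: val_inj.
  by rewrite !ec_val_add p q (ec_sum_line L) (ec_sum_line (ec_line12 L)).
Qed.

#[local] Arguments ec_add_coords : simpl never.

Lemma ec_oppD P Q : - (P + Q) = - P + - Q.
Proof.
case: (ec_add_case P Q) => [->|->|->|].
- by rewrite ec_opp0 !ec_add0p.
- by rewrite ec_opp0 !ec_addp0.
- by rewrite ec_addNp ec_addNp ec_opp0.
- move=> [x1 [x2 [x3 [l [v [L p q]]]]]]; apply: val_inj.
  rewrite !(ec_val_add, ec_val_opp) p q (ec_sum_line L) /=.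
  have h x : (- (l * x + v) - a1 * x - a3 = (- l - a1) * x + (- v - a3))%R by ring.
  by rewrite !h (ec_sum_line (ec_line_opp L)).
Qed.

Lemma ec_addpK P Q : (P + Q) + - Q = P.
Proof.
case: (ec_add_case P Q) => [->|->|->|].
- by rewrite ec_add0p ec_addpN.
- by rewrite ec_opp0 !ec_addp0.
- by rewrite ec_addNp ec_add0p.
- move=> [x1 [x2 [x3 [l [v [L p q]]]]]]; rewrite -[RHS]ec_oppK; apply: val_inj.
  rewrite !(ec_val_add, ec_val_opp) p q (ec_sum_line L) /=.
  have h x : (- (l * x + v) - a1 * x - a3 = (- l - a1) * x + (- v - a3))%R by ring.
  by rewrite !h (ec_sum_line (ec_line13 (ec_line_opp L))).
Qed.

Lemma ec_addKp P Q : Q + (P + - Q) = P.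
Proof. by have := ec_addpK P (- Q); rewrite ec_oppK ec_addpC. Qed.

Definition ec_third_x (l x1 x2 : F) : F := (l ^+ 2 + a1 * l - a2 - x1 - x2)%R.
Definition ec_third_y (l x1 y1 x3 : F) : F := (- (y1 + l * (x3 - x1)) - a1 * x3 - a3)%R.

Lemma ec_add_chord (P Q : ecpoint) x1 y1 x2 y2 :
  val P = Some (x1, y1) -> val Q = Some (x2, y2) -> x2 != x1 ->
  val (P + Q) = Some (ec_third_x ((y2 - y1) / (x2 - x1)) x1 x2,
    ec_third_y ((y2 - y1) / (x2 - x1)) x1 y1 (ec_third_x ((y2 - y1) / (x2 - x1)) x1 x2))%R.
Proof.
move=> p q; rewrite eq_sym => /negbTE h.
by rewrite ec_val_add p q /ec_add_coords /ec_slope h.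
Qed.

Lemma ec_add_tangent (P : ecpoint) x1 y1 (u := (2 * y1 + a1 * x1 + a3)%R)
  (l := ((3 * x1 ^+ 2 + 2 * a2 * x1 + a4 - a1 * y1) / u)%R) :
  val P = Some (x1, y1) -> u != 0%R ->
  val (P + P) = Some (ec_third_x l x1 x1, ec_third_y l x1 y1 (ec_third_x l x1 x1)).
Proof.
move=> p u0; rewrite ec_val_add p /ec_add_coords /ec_slope eqxx /= ifN //.
apply: contraNneq u0 => h; apply/eqP.
by transitivity (y1 - (- y1 - a1 * x1 - a3))%R; [rewrite /u; ring | rewrite -h subrr].
Qed.

Lemma ec_neq_x (P Q : ecpoint) x1 y1 x2 y2 : val P = Some (x1, y1) -> val Q = Some (x2, y2) ->
  P <> Q -> P <> - Q -> x2 != x1.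
Proof.
case: P Q => [p h1] [q h2] /= pE qE; subst p q; move=> n1 n2; apply/eqP => e; subst x2.
case: (ec_same_x h1 h2) => e; subst y1.
- by apply: n1; apply: val_inj.
- by apply: n2; apply: val_inj.
Qed.

Lemma ec_neq0P (P : ecpoint) : P <> 0 -> exists x y, val P = Some (x, y).
Proof.
by case: P => [[[x y]|] h] n; [exists x, y | case: n; apply: val_inj].
Qed.

Lemma ec_eq_third l l' x1 x2 y1 x1' x2' y1' (X := ec_third_x l x1 x2) :
  X = ec_third_x l' x1' x2' -> (y1 + l * (X - x1) = y1' + l' * (X - x1'))%R ->
  Some (X, ec_third_y l x1 y1 X) =
  Some (ec_third_x l' x1' x2', ec_third_y l' x1' y1' (ec_third_x l' x1' x2')).
Proof. by move=> <- e; rewrite /ec_third_y e. Qed.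

Lemma ec_curve_eq (P : ecpoint) x y : val P = Some (x, y) ->
  (y ^+ 2 + a1 * x * y + a3 * y - (x ^+ 3 + a2 * x ^+ 2 + a4 * x + a6) = 0)%R.
Proof. by case: P => p h /= pE; subst p; apply/eqP; rewrite subr_eq0. Qed.

Lemma ec_assoc_generic (P Q R : ecpoint) : P <> 0 -> Q <> 0 -> R <> 0 ->
  P <> Q -> P <> - Q -> Q <> R -> Q <> - R -> P <> R -> P <> - R ->
  P + Q <> R -> P + Q <> - R -> P <> Q + R -> P <> - (Q + R) ->
  P + (Q + R) = (P + Q) + R.
Proof.
move=> /ec_neq0P[x1 [y1 p]] /ec_neq0P[x2 [y2 q]] /ec_neq0P[x3 [y3 r]].
move=> /(ec_neq_x p q) nPQ /nPQ {}nPQ /(ec_neq_x q r) nQR /nQR {}nQR.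
move=> /(ec_neq_x p r) nPR /nPR {}nPR.
have pq := ec_add_chord p q nPQ; have qr := ec_add_chord q r nQR.
move=> /(ec_neq_x pq r) nS /nS {}nS /(ec_neq_x p qr) nT /nT {}nT.
rewrite eq_sym in nS.
rewrite [RHS]ec_addpC; apply: val_inj; rewrite (ec_add_chord r pq nS) (ec_add_chord p qr nT).
rewrite -subr_eq0 in nPQ; rewrite -subr_eq0 in nQR; rewrite -subr_eq0 in nPR.
have := ec_curve_eq p; have := ec_curve_eq q; have := ec_curve_eq r.
move: nS nT; set l := (_ / (x2 - x1))%R; set m := (_ / (x3 - x2))%R.
move=> nS nT h3 h2 h1; pose d := ((m - l) / (x3 - x1))%R.
have mE : m = (l + d * (x3 - x1))%R by rewrite /d divfK // addrC subrK.
have y2E : y2 = (y1 + l * (x2 - x1))%R by rewrite /l divfK // addrC subrK.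
have y3E : y3 = (y2 + m * (x3 - x2))%R by rewrite /m divfK // addrC subrK.
have a2E : a2 = (y1 * d + l * m + d * y3 + a1 * (x1 * d + m) + a3 * d
                 - (x1 + x2 + x3))%R.
  apply/esym/eqP; rewrite -subr_eq0; apply/eqP.
  have h0 : (0 / ((x2 - x1) * (x3 - x1)) - 0 / ((x2 - x1) * (x3 - x2))
             + 0 / ((x3 - x1) * (x3 - x2)) = 0 :> F)%R by rewrite !mul0r oppr0 !addr0.
  rewrite -[RHS]h0 -{1}h1 -{1}h2 -{1}h3.
  rewrite y3E y2E mE; clearbody d m l; field.
  by rewrite nPQ nQR nPR.
clearbody d m l; subst y2 y3 m.
have [eX eY] := ec_assoc_alg a2E nS nT.
by apply: ec_eq_third; [exact: eX | exact: eY].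
Qed.

Lemma ec_assoc_tangent (P R : ecpoint) : P <> 0 -> R <> 0 -> P <> - P ->
  P <> R -> P <> - R -> P + P <> R -> P + P <> - R -> P <> P + R -> P <> - (P + R) ->
  P + (P + R) = (P + P) + R.
Proof.
move=> /ec_neq0P[x1 [y1 p]] /ec_neq0P[x3 [y3 r]] nP.
move=> /(ec_neq_x p r) nPR /nPR {}nPR.
have u0 : (2 * y1 + a1 * x1 + a3 != 0)%R.
  apply/eqP => h; apply: nP; apply: val_inj; rewrite ec_val_opp p /=.
  by congr (Some (_, _)); apply/eqP; rewrite -subr_eq0 -h; apply/eqP; ring.
have pp := ec_add_tangent p u0; have pr := ec_add_chord p r nPR.
move=> /(ec_neq_x pp r) nS /nS {}nS /(ec_neq_x p pr) nT /nT {}nT.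
rewrite eq_sym in nS.
rewrite [RHS]ec_addpC; apply: val_inj; rewrite (ec_add_chord r pp nS) (ec_add_chord p pr nT).
rewrite -subr_eq0 in nPR.
have := ec_curve_eq p; have := ec_curve_eq r.
move: nS nT; set l := (_ / (2 * y1 + a1 * x1 + a3))%R; set m := (_ / (x3 - x1))%R.
move=> nS nT h3 h1; pose d := ((m - l) / (x3 - x1))%R.
have lE : (l * (2 * y1 + a1 * x1 + a3) - (3 * x1 ^+ 2 + 2 * a2 * x1 + a4 - a1 * y1) = 0)%R.
  by rewrite /l divfK // subrr.
have mE : m = (l + d * (x3 - x1))%R by rewrite /d divfK // addrC subrK.
have y3E : y3 = (y1 + l * (x1 - x1) + m * (x3 - x1))%R.
  by rewrite /m divfK // subrr mulr0 addr0 addrC subrK.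
have a2E : a2 = (y1 * d + l * m + d * y3 + a1 * (x1 * d + m) + a3 * d
                 - (x1 + x1 + x3))%R.
  apply/esym/eqP; rewrite -subr_eq0; apply/eqP.
  have h0 : (0 / (x3 - x1) ^+ 2 - 0 / (x3 - x1) ^+ 2 - 0 / (x3 - x1) = 0 :> F)%R.
    by rewrite !mul0r oppr0 !addr0.
  rewrite -[RHS]h0 -{1}h3 -{1}h1 -{1}lE.
  by rewrite y3E mE; clearbody d m l; field; rewrite nPR.
clearbody d m l; subst y3 m.
have [eX eY] := ec_assoc_alg a2E nS nT.
have e0 : (y1 + l * (x1 - x1) = y1)%R by rewrite subrr mulr0 addr0.
rewrite !e0 in eX eY *.
by apply: ec_eq_third; [exact: eX | exact: eY].
Qed.

Lemma ec_add_inj P Q R : P + R = Q + R -> P = Q.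
Proof. by move=> e; rewrite -(ec_addpK P R) e ec_addpK. Qed.

Lemma ec_oppR P Q : P = - Q -> Q = - P.
Proof. by move=> ->; rewrite ec_oppK. Qed.

Lemma ec_assoc_opp P Q R : P = - Q -> P + (Q + R) = (P + Q) + R.
Proof. by move=> ->; rewrite ec_addNp ec_add0p ec_addpC [Q + R]ec_addpC ec_addpK. Qed.

Lemma ec_assoc_opp_sum P Q R : P + Q = - R -> P + (Q + R) = (P + Q) + R.
Proof.
move=> e; have -> : R = - P + - Q by rewrite -ec_oppD e ec_oppK.
by rewrite ec_addKp ec_addpN -ec_oppD ec_addpN.
Qed.

Lemma ec_assoc_rev P Q R : R + (Q + P) = (R + Q) + P -> P + (Q + R) = (P + Q) + R.
Proof. by move=> e; rewrite [P + _]ec_addpC [Q + R]ec_addpC -e [R + _]ec_addpC [Q + P]ec_addpC. Qed.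

Lemma ec_eqp_dec (P Q : ecpoint) : P = Q \/ P <> Q.
Proof. by case: (P =P Q); [left | right]. Qed.

Lemma ec_assoc_dbl_neq P R : P + P <> R -> P + (P + R) = (P + P) + R.
Proof.
move=> n2.
have [->|P0] := ec_eqp_dec P 0; first by rewrite !ec_add0p.
have [->|R0] := ec_eqp_dec R 0; first by rewrite !ec_addp0.
have [/ec_assoc_opp|nP] := ec_eqp_dec P (- P); first exact.
have [<-|nPR] := ec_eqp_dec P R; first exact: ec_addpC.
have [e|nPR'] := ec_eqp_dec P (- R).
  by apply: ec_assoc_rev; rewrite ec_assoc_opp //; exact: ec_oppR.
have [/ec_assoc_opp_sum|n2'] := ec_eqp_dec (P + P) (- R); first exact.
apply: ec_assoc_tangent => //.
- by move=> e; apply: R0; apply: (@ec_add_inj _ _ P); rewrite ec_add0p ec_addpC.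
- move=> e; apply: n2'; apply: ec_oppR.
  by rewrite -[R](ec_addpK _ P) [R + P]ec_addpC (ec_oppR e) -ec_oppD.
Qed.

Lemma ec_assoc_dbl P R : P + (P + R) = (P + P) + R.
Proof.
have [eR|] := ec_eqp_dec (P + P) R; last exact: ec_assoc_dbl_neq.
have RP : R + - P = P by rewrite -eR ec_addpK.
rewrite eR; have [e|n] := ec_eqp_dec (R + R) (- P).
  have eP : P + R = - R.
    by apply: ec_oppR; rewrite ec_oppD -e ec_addpK.
  by rewrite eP e -eR ec_oppD ec_addKp.
have := ec_assoc_dbl_neq n; rewrite RP => e.
by rewrite -[RHS](ec_addpK _ (- P)) -e ec_oppK [RHS]ec_addpC [R + P]ec_addpC.
Qed.

Lemma ec_addpA : associative ec_add_point.
Proof.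
move=> P Q R.
have [->|P0] := ec_eqp_dec P 0; first by rewrite !ec_add0p.
have [->|Q0] := ec_eqp_dec Q 0; first by rewrite ec_add0p ec_addp0.
have [->|R0] := ec_eqp_dec R 0; first by rewrite !ec_addp0.
have [/ec_assoc_opp|nPQ'] := ec_eqp_dec P (- Q); first exact.
have [e|nQR'] := ec_eqp_dec Q (- R).
  by apply: ec_assoc_rev; rewrite ec_assoc_opp //; exact: ec_oppR.
have [e|nPR'] := ec_eqp_dec P (- R).
  by rewrite e [- R + Q]ec_addpC -{2 4}[R]ec_oppK ec_addKp ec_addpK.
have [<-|nPQ] := ec_eqp_dec P Q; first exact: ec_assoc_dbl.
have [<-|nQR] := ec_eqp_dec Q R; first by apply: ec_assoc_rev; rewrite ec_assoc_dbl.
have [<-|nPR] := ec_eqp_dec P R; first by rewrite ec_addpC [Q + P]ec_addpC.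
have [/ec_assoc_opp_sum|nS'] := ec_eqp_dec (P + Q) (- R); first exact.
have [e|nT'] := ec_eqp_dec P (- (Q + R)).
  by apply: ec_assoc_rev; rewrite ec_assoc_opp_sum // ec_addpC (ec_oppR e).
have sum_case A B C : A + B = C -> A + (B + C) = (A + B) + C.
  move=> e; have eB : B = C + - A by rewrite -e [A + B]ec_addpC ec_addpK.
  by rewrite e [B + C]ec_addpC {1}eB ec_assoc_dbl ec_addKp.
have [/sum_case|nS] := ec_eqp_dec (P + Q) R; first exact.
have [e|nT] := ec_eqp_dec P (Q + R).
  by apply: ec_assoc_rev; apply: sum_case; rewrite ec_addpC.
exact: ec_assoc_generic.
Qed.

HB.instance Definition _ := GRing.isZmodule.Build ecpoint ec_addpA ec_addpC ec_add0p ec_addNp.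

End EllipticCurveGroup.

Section Torsion.
Variable G : zmodType.

Definition torsion : {pred G} :=
  fun P => `[< exists2 n, (0 < n)%N & P *+ n = 0 >].

Lemma torsion_zmod_closed : zmod_closed torsion.
Proof.
split=> [|P Q]; first by apply/asboolP; exists 1%N.
move=> /asboolP[m m0 Pm] /asboolP[n n0 Qn]; apply/asboolP.
exists (m * n)%N; first by rewrite muln_gt0 m0.
by rewrite mulrnBl mulrnA Pm mul0rn mulnC mulrnA Qn mul0rn subr0.
Qed.

HB.instance Definition _ := GRing.isZmodClosed.Build G torsion torsion_zmod_closed.

Definition torsion_quotient := Quotient.quot torsion.

HB.instance Definition _ := Choice.on torsion_quotient.
HB.instance Definition _ := Quotient.on torsion_quotient.
HB.instance Definition _ := GRing.Zmodule.on torsion_quotient.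
End Torsion.

Definition is_basis (M : zmodType) (r : nat) (P : 'I_r -> M) : Prop :=
  forall m : M, exists! c : {ffun 'I_r -> int}, m = \sum_i P i *~ c i.

Section TensorProduct.
Variables (R : nzRingType) (M : zmodType).

(* M (x)_Z R is the free R-module on M modulo [m + n] - [m] - [n] *)
Inductive tensor_relation : {freeg M / R} -> Prop :=
| Tensor_rel0 : tensor_relation 0
| Tensor_relD (a : R) (m n : M) (D : {freeg M / R}) : tensor_relation D ->
    tensor_relation (a *: (<< m + n >> - << m >> - << n >>) + D).

Definition tensor_rel : {pred {freeg M / R}} := fun D => `[< tensor_relation D >].

Lemma tensor_relationD D1 D2 :
  tensor_relation D1 -> tensor_relation D2 -> tensor_relation (D1 + D2).
Proof.
by elim=> [|a m n D _ IH] h; [rewrite add0r | rewrite -addrA; constructor; apply: IH].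
Qed.

Lemma tensor_relationZ a D : tensor_relation D -> tensor_relation (a *: D).
Proof.
elim=> [|b m n D' _ IH]; first by rewrite scaler0; constructor.
by rewrite scalerDr scalerA; constructor.
Qed.

Lemma tensor_rel_zmod_closed : zmod_closed tensor_rel.
Proof.
split=> [|D1 D2]; first by apply/asboolP; constructor.
move=> /asboolP h1 /asboolP h2; apply/asboolP; apply: tensor_relationD => //.
by rewrite -scaleN1r; apply: tensor_relationZ.
Qed.

HB.instance Definition _ :=
  GRing.isZmodClosed.Build {freeg M / R} tensor_rel tensor_rel_zmod_closed.

Definition tensor := Quotient.quot tensor_rel.

HB.instance Definition _ := Choice.on tensor.
HB.instance Definition _ := Quotient.on tensor.
HB.instance Definition _ := GRing.Zmodule.on tensor.

Definition tensor_scale (a : R) (v : tensor) : tensor := \pi_(tensor) (a *: repr v).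

Lemma tensor_scale_pi a D : tensor_scale a (\pi_(tensor) D) = \pi_(tensor) (a *: D).
Proof.
apply/eqP; rewrite /tensor_scale -[_ == _]Quotient.idealrBE -scalerBr.
apply/asboolP/tensor_relationZ/asboolP.
rewrite -[X in is_true X]/(repr (\pi_(tensor) D) - D \in tensor_rel).
by rewrite Quotient.idealrBE reprK.
Qed.

Lemma tensor_scaleA a b v : tensor_scale a (tensor_scale b v) = tensor_scale (a * b) v.
Proof. by rewrite [tensor_scale b v]/tensor_scale tensor_scale_pi scalerA. Qed.

Lemma tensor_scale1 : left_id 1 tensor_scale.
Proof. by move=> v; rewrite /tensor_scale scale1r reprK. Qed.

Lemma tensor_scaleDr : right_distributive tensor_scale +%R.
Proof.
move=> a v w; rewrite -{1}[v]reprK -{1}[w]reprK -raddfD tensor_scale_pi.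
by rewrite scalerDr raddfD.
Qed.

Lemma tensor_scaleDl v : {morph tensor_scale^~ v : a b / a + b}.
Proof.
by move=> a b /=; rewrite /tensor_scale scalerDl raddfD.
Qed.

HB.instance Definition _ := GRing.Zmodule_isLmodule.Build R tensor
  tensor_scaleA tensor_scale1 tensor_scaleDr tensor_scaleDl.

Definition tensor_of (m : M) : tensor := \pi_(tensor) << m >>.

Lemma tensor_ofD : {morph tensor_of : m n / m + n}.
Proof.
move=> m n; rewrite /tensor_of -raddfD; apply/eqP.
rewrite -[_ == _]Quotient.idealrBE; apply/asboolP.
by rewrite -[X in tensor_relation X]addr0 -[X in X + 0]scale1r opprD addrA; do 2!constructor.
Qed.

Lemma tensor_of_nmod_morphism : nmod_morphism tensor_of.
Proof.
split; last exact: tensor_ofD.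
by apply: (@addrI _ (tensor_of 0)); rewrite -tensor_ofD !addr0.
Qed.

HB.instance Definition _ := GRing.isNmodMorphism.Build M tensor tensor_of
  tensor_of_nmod_morphism.

(* The bilinear extension of a biadditive map b : M * M -> R, evaluated on
   representatives of the two tensors. *)
Definition tensor_form (b : M -> M -> R) (v w : tensor) : R :=
  \sum_(m <- dom (repr v)) \sum_(n <- dom (repr w))
    coeff m (repr v) * coeff n (repr w) * b m n.
End TensorProduct.

Definition mordell_weil (E : ellcurve rat) : zmodType := torsion_quotient (ecpoint E).

Section HeightTorus.
Variables (R : realType) (E : ellcurve rat).
Local Notation MW := (mordell_weil E).

(* logarithmic Weil height on P^1(Q), [None] being the point at infinity *)
Definition weil_height (x : option rat) : R :=
  if x is Some q then ln (Num.max `|(numq q)%:~R| `|(denq q)%:~R|) else 0.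

Definition x_coord (P : ecpoint E) : option rat := omap fst (coords P).

(* twice the height in Silverman's normalization *)
Definition canonical_height (P : ecpoint E) : R :=
  limn (fun n : nat => (4 ^- n * weil_height (x_coord (P *+ 2 ^ n))) : R).

Definition height_pairing (P Q : ecpoint E) : R :=
  2^-1 * (canonical_height (P + Q) - canonical_height P - canonical_height Q).

(* evaluated on representatives: the pairing is invariant under torsion *)
Definition mw_pairing (m n : MW) : R := height_pairing (repr m) (repr n).

Definition gram r (P : 'I_r -> MW) : 'M[R]_r := \matrix_(i, j) mw_pairing (P i) (P j).

(* [get] picks the common value of these determinants over all bases *)
Definition regulator : R :=
  get [set d : R | exists r (P : 'I_r -> MW), is_basis P /\ d = \det (gram P)].

Definition height_space : lmodType R := tensor R MW.

Definition height_inner (v w : height_space) : R := tensor_form mw_pairing v w.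

Definition height_norm (v : height_space) : R := Num.sqrt (height_inner v v).

Definition height_lattice : {pred height_space} :=
  fun v => `[< exists m : MW, v = tensor_of R m >].

Lemma height_lattice_zmod_closed : zmod_closed height_lattice.
Proof.
split=> [|v w]; first by apply/asboolP; exists 0; rewrite raddf0.
move=> /asboolP[m ->] /asboolP[n ->]; apply/asboolP.
by exists (m - n); rewrite raddfB.
Qed.

HB.instance Definition _ :=
  GRing.isZmodClosed.Build height_space height_lattice height_lattice_zmod_closed.

Definition height_torus := Quotient.quot height_lattice.

HB.instance Definition _ := Choice.on height_torus.
HB.instance Definition _ := Quotient.on height_torus.
HB.instance Definition _ := GRing.Zmodule.on height_torus.

(* distance of the quotient flat metric: the lattice acts by translations, so it
   is the infimum of the distances between lifts *)
Definition torus_dist (x y : height_torus) : R :=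
  inf [set d | exists v w : height_space,
    [/\ \pi_(height_torus) v = x, \pi_(height_torus) w = y & d = height_norm (v - w)]].

(* metric length of a curve [0, 1] -> height_torus; it agrees with the Riemannian
   length for the flat metric *)
Definition curve_length (g : R -> height_torus) : \bar R :=
  ereal_sup [set (\sum_(0 <= i < size s)
      torus_dist (g (nth 1 (0 :: s) i)) (g (nth 1 (0 :: s) i.+1)))%:E
    | s in itv_partition 0 1].

Definition closed_geodesic (m : MW) (t : R) : height_torus :=
  \pi_(height_torus) (t *: tensor_of R m).

Definition geodesic_length (m : MW) : \bar R := curve_length (closed_geodesic m).
End HeightTorus.

Definition isometric_tori (R : realType) (E E' : ellcurve rat) : Prop :=
  exists2 f : height_torus R E -> height_torus R E',
    bijective f & forall x y, torus_dist (f x) (f y) = torus_dist x y.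

(* Main.v *)
From HB Require Import structures.
Require Import Defs.
From mathcomp Require Import all_boot all_order all_algebra.
From mathcomp Require Import generic_quotient ring_quotient freeg.
From mathcomp Require Import all_classical all_reals all_analysis.
From mathcomp Require Import ring lra zify.

Set Implicit Arguments.
Unset Strict Implicit.
Unset Printing Implicit Defensive.

Import Order.TTheory GRing.Theory Num.Theory.
Import numFieldNormedType.Exports.
Local Open Scope classical_set_scope.
Local Open Scope ring_scope.
Local Open Scope quotient_scope.

(** The whole statement rests on one fact: the length of the geodesic attached to
    m in M_E is sqrt <m, m>.  Given this, the first two formulas are the
    polarization identity, equal marked lengths give equal Gram matrices, and the
    isomorphism of the Mordell-Weil lattices that matches the two bases preserves
    the pairing; it therefore carries bases to bases with the same Gram matrix
    (equality of regulators), and its real-linear extension descends to an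
    isometric bijection of the tori ([iso_of_gram]).

    Why the length is sqrt <m, m>.  The distance between gamma_m(s) and gamma_m(t)
    is the infimum over l in M_E of the norms of (s - t) m + l.  Taking l = 0 gives
    at most |s - t| sqrt <m, m>.  For the converse one needs, when |s - t| is small
    and l is nonzero, that 2 (s - t) <m, l> + <l, l> be nonnegative.  This follows
    from a Cauchy-Schwarz estimate in M_E as soon as <l, l> stays away from 0
    ([mw_pairing_gap]), so fine partitions of [0, 1] have polygonal length exactly
    sqrt <m, m>.

    What has to be known about the canonical height is thus: it exists, it is
    nonnegative and satisfies the parallelogram law (so that the pairing is
    biadditive and blind to torsion), and it is bounded below by a positive
    constant on nontorsion points.

    The first part is the argument of Tate.  If a nonnegative function h on an
    abelian group satisfies, up to a bounded error, both
    h(x + y) + h(x - y) <= 2 h(x) + 2 h(y) and 4 h(x) <= h(2x), then 4^-n h(2^n x)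
    converges, stays within a bounded distance of h, and satisfies the
    parallelogram law exactly: the missing inequality comes from applying the
    first one to the pair (x + y, x - y).

    For the logarithmic height of the x-coordinate these two inequalities are
    [mheight_sum_diff_le] and [mheight_dbl_ge].  The first holds because the
    elementary symmetric functions of x(P + Q) and x(P - Q) are given by forms of
    bidegree (2, 2) in the coordinates of x(P) and x(Q).  The second holds because
    the two quartic forms giving x(2P) have no common zero: explicit cofactors
    express Delta x^7 and Delta z^7 through them, which bounds both their common
    factors and the size of x(2P) from below.

    The lower bound on nontorsion points is a pigeonhole argument resting on the
    finiteness of the set of points of bounded height: if the canonical height of
    P is tiny, then too many multiples of P have bounded height. *)

(** * The x-coordinates of P + Q and P - Q *)

Section XCoordinates.
Variables (F : fieldType) (E : ellcurve F).
Local Notation a1 := (ec_a1 E).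
Local Notation a2 := (ec_a2 E).
Local Notation a3 := (ec_a3 E).
Local Notation a4 := (ec_a4 E).
Local Notation a6 := (ec_a6 E).

Definition ec_b2 : F := a1 ^+ 2 + 4 * a2.
Definition ec_b4 : F := 2 * a4 + a1 * a3.
Definition ec_b6 : F := a3 ^+ 2 + 4 * a6.
Definition ec_b8 : F :=
  a1 ^+ 2 * a6 + 4 * a2 * a6 - a1 * a3 * a4 + a2 * a3 ^+ 2 - a4 ^+ 2.
Definition ec_disc : F := weierstrass_disc a1 a2 a3 a4 a6.

(** The sum and the product of x(P + Q) and x(P - Q) are [sumdiff_sum] and
    [sumdiff_prod] divided by [sumdiff_den], bihomogeneously in (x1 : z1) and
    (x2 : z2).  On the diagonal, [sumdiff_prod] and [sumdiff_sum] are the numerator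
    and the denominator of the duplication formula. *)
Definition sumdiff_den (x1 z1 x2 z2 : F) : F := (x1 * z2 - x2 * z1) ^+ 2.
Definition sumdiff_sum (x1 z1 x2 z2 : F) : F :=
  2 * (x1 * x2) * (x1 * z2 + x2 * z1) + ec_b2 * (x1 * x2) * (z1 * z2)
  + ec_b4 * (x1 * z2 + x2 * z1) * (z1 * z2) + ec_b6 * (z1 * z2) ^+ 2.
Definition sumdiff_prod (x1 z1 x2 z2 : F) : F :=
  (x1 * x2) ^+ 2 - ec_b4 * (x1 * x2) * (z1 * z2)
  - ec_b6 * (x1 * z2 + x2 * z1) * (z1 * z2) - ec_b8 * (z1 * z2) ^+ 2.

(** The x-coordinate as a point (proj_x : proj_z) of the projective line, the point
    at infinity of the curve being sent to (1 : 0). *)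
Definition proj_x (P : ecpoint E) : F := if coords P is Some (x, _) then x else 1.
Definition proj_z (P : ecpoint E) : F := if coords P is Some _ then 1 else 0.

(** The three forms at (P, Q) are proportional to the coefficients of the binary
    quadratic form whose zeros are x(S) and x(T).  Stated projectively, this makes
    sense in all degenerate cases of the addition law. *)
Definition sumdiff_rel (P Q S T : ecpoint E) : Prop := exists2 g : F, g != 0 &
  [/\ sumdiff_den (proj_x P) (proj_z P) (proj_x Q) (proj_z Q) = g * (proj_z S * proj_z T),
      sumdiff_sum (proj_x P) (proj_z P) (proj_x Q) (proj_z Q) =
        g * (proj_x S * proj_z T + proj_x T * proj_z S) &
      sumdiff_prod (proj_x P) (proj_z P) (proj_x Q) (proj_z Q) = g * (proj_x S * proj_x T)].

Lemma sumdiff_rel_swap P Q S T : sumdiff_rel P Q S T -> sumdiff_rel P Q T S.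
Proof.
case=> g g0 [e1 e2 e3]; exists g => //; split.
- by rewrite e1 [proj_z T * _]mulrC.
- by rewrite e2 [proj_x T * _ + _]addrC.
- by rewrite e3 [proj_x T * _]mulrC.
Qed.

Lemma proj_xzE (P : ecpoint E) x y : coords P = Some (x, y) -> proj_x P = x /\ proj_z P = 1.
Proof. by rewrite /proj_x /proj_z => ->. Qed.

Lemma proj_xN (P : ecpoint E) : proj_x (- P) = proj_x P.
Proof. by case: P => [[[x y]|] h]. Qed.

Lemma proj_zN (P : ecpoint E) : proj_z (- P) = proj_z P.
Proof. by case: P => [[[x y]|] h]. Qed.

(** With u = 2y + a1 x + a3 and n / u the slope of the tangent, the denominator of
    x(2P) is u^2 on the curve and the numerator reduces to n^2 when u = 0.  For a
    point of order 2 the factor of proportionality is therefore n^2, which is nonzero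
    because the curve is smooth. *)
Lemma sumdiff_rel_dbl (P : ecpoint E) : sumdiff_rel P P (P + P) 0.
Proof.
case cP: (coords P) => [[x y]|]; last first.
  have -> : P = 0 by exact: val_inj.
  rewrite addr0; exists 1; rewrite ?oner_eq0 // /sumdiff_den /sumdiff_sum /sumdiff_prod.
  by rewrite /proj_x /proj_z /=; split; ring.
have [pE zE] := proj_xzE cP.
have /eqP onP : ec_on_curve E (Some (x, y)) by rewrite -cP; exact: coordsP.
have a6E : a6 = y ^+ 2 + a1 * x * y + a3 * y - (x ^+ 3 + a2 * x ^+ 2 + a4 * x).
  by rewrite onP; ring.
pose u := 2 * y + a1 * x + a3; pose n := 3 * x ^+ 2 + 2 * a2 * x + a4 - a1 * y.
have SE : sumdiff_sum x 1 x 1 = u ^+ 2.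
  by rewrite /sumdiff_sum /u /ec_b2 /ec_b4 /ec_b6 a6E; ring.
have TE : sumdiff_prod x 1 x 1 = n ^+ 2 + a1 * n * u - (a2 + 2 * x) * u ^+ 2.
  by rewrite /sumdiff_prod /u /n /ec_b4 /ec_b6 /ec_b8 a6E; ring.
have DE : sumdiff_den x 1 x 1 = 0 by rewrite /sumdiff_den subrr expr0n.
have x0E : proj_x (0 : ecpoint E) = 1 by [].
have z0E : proj_z (0 : ecpoint E) = 0 by [].
have [u0|u0] := eqVneq u 0.
  have -> : P + P = 0.
    have <- : - P + P = 0 by exact: addNr.
    congr (_ + _); apply: val_inj; change (coords P = ec_opp_coords E (coords P)).
    rewrite cP /=; congr (Some (_, _)); apply/eqP; rewrite -subr_eq0 -u0 /u; apply/eqP; ring.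
  have n0 : n != 0.
    by apply/eqP => n0; apply: (@ec_nonsingular _ E x y) => //; exact/eqP.
  exists (n ^+ 2); first by rewrite expf_neq0.
  rewrite pE zE x0E z0E SE TE DE u0; split; ring.
have := ec_add_tangent (P := P) cP u0; rewrite -/n -/u => vE.
have [pD zD] := proj_xzE (P := P + P) vE.
exists (u ^+ 2); first by rewrite expf_neq0.
rewrite pE zE pD zD x0E z0E SE TE DE; split; [ring|ring|].
by rewrite /ec_third_x; field.
Qed.

Lemma sumdiff_rel_generic (P Q : ecpoint E) x1 y1 x2 y2 :
  coords P = Some (x1, y1) -> coords Q = Some (x2, y2) -> x1 != x2 ->
  sumdiff_rel P Q (P + Q) (P - Q).
Proof.
move=> cP cQ n12; have d : x2 - x1 != 0 by rewrite subr_eq0 eq_sym.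
have cN : coords (- Q) = Some (x2, - y2 - a1 * x2 - a3).
  by change (ec_opp_coords E (coords Q) = Some (x2, - y2 - a1 * x2 - a3)); rewrite cQ.
have n21 : x2 != x1 by rewrite eq_sym.
have [pP zP] := proj_xzE cP; have [pQ zQ] := proj_xzE cQ.
have [pS zS] := proj_xzE (P := P + Q) (ec_add_chord (P := P) (Q := Q) cP cQ n21).
have [pT zT] := proj_xzE (P := P - Q) (ec_add_chord (P := P) (Q := - Q) cP cN n21).
have /eqP h1 : ec_on_curve E (Some (x1, y1)) by rewrite -cP; exact: coordsP.
have /eqP h2 : ec_on_curve E (Some (x2, y2)) by rewrite -cQ; exact: coordsP.
pose w := y2 ^+ 2 + a1 * x2 * y2 + a3 * y2 - (y1 ^+ 2 + a1 * x1 * y1 + a3 * y1).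
(* The two curve equations determine a6 and, as x1 and x2 differ, a4. *)
have a4E : a4 = w / (x2 - x1) - (x2 ^+ 2 + x1 * x2 + x1 ^+ 2) - a2 * (x1 + x2).
  by rewrite /w h1 h2; field.
have a6E : a6 = y1 ^+ 2 + a1 * x1 * y1 + a3 * y1 - (x1 ^+ 3 + a2 * x1 ^+ 2 + a4 * x1).
  by rewrite h1; ring.
exists ((x2 - x1) ^+ 2); first by rewrite expf_neq0.
rewrite pP zP pQ zQ pS zS pT zT; split.
- by rewrite /sumdiff_den; ring.
- rewrite /sumdiff_sum /ec_b2 /ec_b4 /ec_b6 /ec_third_x a6E a4E /w; clear -d; field; exact: d.
- rewrite /sumdiff_prod /ec_b4 /ec_b6 /ec_b8 /ec_third_x a6E a4E /w; clear -d; field; exact: d.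
Qed.

Lemma sumdiff_relP (P Q : ecpoint E) : sumdiff_rel P Q (P + Q) (P - Q).
Proof.
case cP: (coords P) => [[x1 y1]|]; last first.
  have -> : P = 0 by exact: val_inj.
  rewrite add0r sub0r; exists 1; rewrite ?oner_eq0 // proj_xN proj_zN.
  rewrite /sumdiff_den /sumdiff_sum /sumdiff_prod.
  have -> : proj_x (0 : ecpoint E) = 1 by [].
  have -> : proj_z (0 : ecpoint E) = 0 by [].
  by split; ring.
case cQ: (coords Q) => [[x2 y2]|]; last first.
  have -> : Q = 0 by exact: val_inj.
  rewrite addr0 subr0; exists 1; rewrite ?oner_eq0 // /sumdiff_den /sumdiff_sum /sumdiff_prod.
  have -> : proj_x (0 : ecpoint E) = 1 by [].
  have -> : proj_z (0 : ecpoint E) = 0 by [].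
  by split; ring.
have [eqx|] := eqVneq x1 x2; last exact: sumdiff_rel_generic cP cQ.
have [eqP|neqP] := eqVneq P Q; first by rewrite -eqP subrr; exact: sumdiff_rel_dbl.
have -> : P = - Q.
  case: (eqVneq P (- Q)) => // /eqP nP; case/eqP: (ec_neq_x cP cQ (elimN eqP neqP) nP).
  by rewrite eqx.
rewrite addNr -opprD; apply: sumdiff_rel_swap.
case: (sumdiff_rel_dbl Q) => g g0 h; exists g => //.
by rewrite !proj_xN !proj_zN.
Qed.

Definition cubic (c3 c2 c1 c0 x z : F) : F :=
  c3 * x ^+ 3 + c2 * x ^+ 2 * z + c1 * x * z ^+ 2 + c0 * z ^+ 3.
(** Cofactors of the numerator T and the denominator S of the duplication formula
    expressing Delta z^7 and Delta x^7.  The first two are the classical Bezout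
    relation for the polynomials of the duplication formula; the other two come from
    solving the linear system for a combination equal to Delta x^7, using
    4 b8 = b2 b6 - b4^2 to clear denominators. *)
Definition dup_cofactor_zT : F -> F -> F :=
  cubic 0 (- 48) (- (8 * ec_b2)) (ec_b2 ^+ 2 - 32 * ec_b4).
Definition dup_cofactor_zS : F -> F -> F :=
  cubic 12 (- ec_b2) (- (10 * ec_b4)) (ec_b2 * ec_b4 - 27 * ec_b6).
Definition dup_cofactor_xT : F -> F -> F := cubic ec_disc
  (4 * (ec_b2 * ec_b4 * ec_b8 - ec_b6 * ec_b8 - ec_b2 * ec_b6 ^+ 2))
  (12 * ec_b4 ^+ 2 * ec_b8 - ec_b2 * ec_b6 * ec_b8 - 11 * ec_b4 * ec_b6 ^+ 2)
  (6 * (ec_b4 * ec_b6 * ec_b8 - ec_b6 ^+ 3)).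
Definition dup_cofactor_xS : F -> F -> F := cubic
  (ec_b2 * ec_b6 ^+ 2 + ec_b6 * ec_b8 - ec_b2 * ec_b4 * ec_b8)
  (5 * ec_b4 ^+ 2 * ec_b8 - ec_b2 * ec_b6 * ec_b8 - 4 * ec_b4 * ec_b6 ^+ 2)
  (13 * ec_b4 * ec_b6 * ec_b8 - ec_b2 * ec_b8 ^+ 2 - 12 * ec_b6 ^+ 3)
  (6 * (ec_b4 * ec_b8 ^+ 2 - ec_b6 ^+ 2 * ec_b8)).

Lemma dup_bezout_z x z :
  dup_cofactor_zT x z * sumdiff_prod x z x z
  + dup_cofactor_zS x z * sumdiff_sum x z x z = ec_disc * z ^+ 7.
Proof.
rewrite /dup_cofactor_zT /dup_cofactor_zS /cubic /sumdiff_prod /sumdiff_sum.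
by rewrite /ec_disc /weierstrass_disc /ec_b8 /ec_b2 /ec_b4 /ec_b6; ring.
Qed.

Lemma dup_bezout_x x z :
  dup_cofactor_xT x z * sumdiff_prod x z x z
  + dup_cofactor_xS x z * sumdiff_sum x z x z = ec_disc * x ^+ 7.
Proof.
rewrite /dup_cofactor_xT /dup_cofactor_xS /cubic /sumdiff_prod /sumdiff_sum.
by rewrite /ec_disc /weierstrass_disc /ec_b8 /ec_b2 /ec_b4 /ec_b6; ring.
Qed.
End XCoordinates.

(** * Heights of rational numbers *)

(** Coprime integral coordinates of a point of the projective line over the
    rationals, kept as rationals so that they can be combined with the coefficients
    of the curve. *)
Definition hnum (x : option rat) : rat := if x is Some q then (numq q)%:~R else 1.
Definition hden (x : option rat) : rat := if x is Some q then (denq q)%:~R else 0.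
Definition mheight (x : option rat) : rat := Num.max `|hnum x| `|hden x|.

Lemma hnum_int x : hnum x \is a Num.int.
Proof. by case: x => [q|] /=; rewrite ?intr_int ?rpred1. Qed.

Lemma hden_int x : hden x \is a Num.int.
Proof. by case: x => [q|] /=; rewrite ?intr_int ?rpred0. Qed.

Lemma le_hnum_mheight x : `|hnum x| <= mheight x.
Proof. by rewrite /mheight le_max lexx. Qed.

Lemma le_hden_mheight x : `|hden x| <= mheight x.
Proof. by rewrite /mheight le_max lexx orbT. Qed.

Lemma mheight_ge1 x : 1 <= mheight x.
Proof.
case: x => [q|]; last by apply: le_trans (le_hnum_mheight _); rewrite normr1.
apply: le_trans (le_hden_mheight _).
by apply: norm_intr_ge1; rewrite ?intr_int // intr_eq0 denq_neq0.
Qed.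

Lemma mheight_gt0 x : 0 < mheight x.
Proof. exact: lt_le_trans (mheight_ge1 x). Qed.

Definition primitive (x z : rat) : Prop :=
  exists u v, [/\ u \is a Num.int, v \is a Num.int & u * x + v * z = 1].

Lemma hcoord_primitive n x : primitive (hnum x ^+ n) (hden x ^+ n).
Proof.
case: x => [q|] /=; last first.
  by exists 1, 0; rewrite rpred0 rpred1 expr1n mul0r addr0 mul1r.
have /coprimezP[[u v] /= e] : coprimez (numq q ^+ n) (denq q ^+ n).
  by rewrite coprimezXl ?coprimezXr //; exact: coprime_num_den.
exists u%:~R, v%:~R; split; rewrite ?intr_int //.
by move/(congr1 (intr : int -> rat)): e; rewrite /= intrD !intrM !rmorphXn.
Qed.

(** Up to a factor 2, the height of a product of two binary linear forms is the
    product of their heights.  Only the mixed products p v and u q are at stake: if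
    one of them exceeded 2 M the other would exceed M, as their sum is at most M,
    and their product, which equals (p u)(q v), would exceed M^2. *)
Lemma max_mul_le_sym (p q u v M : rat) :
  `|q * v| <= M -> `|p * v + u * q| <= M -> `|p * u| <= M ->
  Num.max `|p| `|q| * Num.max `|u| `|v| <= 2 * M.
Proof.
move=> h1 h2 h3.
have M0 : 0 <= M by exact: le_trans h1.
have cross (a b : rat) : a * b = (p * u) * (q * v) -> `|a + b| <= M -> `|a| <= 2 * M.
  move=> eab hab; rewrite leNgt; apply/negP => ha.
  have hb : M < `|b|.
    have := ler_normB (a + b) b; rewrite addrK; lra.
  have hab' : `|a| * `|b| <= M * M.
    by rewrite -normrM eab normrM; apply: ler_pM.
  suff : M * M < `|a| * `|b| by rewrite ltNge hab'.
  apply: ltr_pM => //; lra.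
have hpv : `|p * v| <= 2 * M by apply: (cross _ (u * q)) => //; ring.
have huq : `|u * q| <= 2 * M.
  by apply: (cross _ (p * v)); [ring | rewrite addrC].
have h1' : `|q * v| <= 2 * M by lra.
have h3' : `|p * u| <= 2 * M by lra.
rewrite !normrM [`|u| * _]mulrC in hpv huq h1' h3'.
by case: (leP `|p| `|q|) => _; case: (leP `|u| `|v|) => _.
Qed.

Lemma norm_mul_max_exp (d x z : rat) n :
  `|d| * Num.max `|x| `|z| ^+ n = Num.max `|d * x ^+ n| `|d * z ^+ n|.
Proof.
rewrite !(normrM d) -maxr_pMr // !normrX; congr (_ * _).
by case: (leP `|x| `|z|) => [h|/ltW h]; [rewrite max_r | rewrite max_l];
  rewrite // lerXn2r ?nnegrE.
Qed.

Lemma common_denominator (s : seq rat) : exists N : rat,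
  [/\ 0 < N, N \is a Num.int & forall c, c \in s -> N * c \is a Num.int].
Proof.
elim: s => [|c s [N [N0 NZ hN]]]; first by exists 1; rewrite rpred1.
exists ((denq c)%:~R * N); split.
- by rewrite mulr_gt0 // ltr0z denq_gt0.
- by rewrite rpredM ?intr_int.
- move=> d; rewrite inE => /orP[/eqP -> | /hN h].
    by rewrite mulrAC [_ * c]mulrC -numqE rpredM ?intr_int.
  by rewrite -mulrA rpredM ?intr_int.
Qed.

(** Closes integrality goals by structural descent.  A product N (b u) is
    reassociated when N b is known to be integral, so that a common denominator
    meets the coefficient that it clears. *)
Ltac int_closed := repeat
  match goal with |- is_true (in_mem ?a _) =>
    change (is_true (a \is a Num.int));
    first [ assumption
    | match goal with
      | h : is_true (in_mem (?N * ?b) _) |- is_true (in_mem (?N * (?b * ?u)) _) =>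
        rewrite (mulrA N b u)
      end
    | lazymatch a with
      | _%:R => apply: rpred_nat
      | _ + _ => apply: rpredD
      | - _ => rewrite rpredN
      | ?c * (?d + ?e) => rewrite (mulrDr c d e)
      | ?c * - ?d => rewrite (mulrN c d)
      | _ * _ => apply: rpredM
      | _ ^+ _ => apply: rpredX
      end ]
  end.

(** Gauss's lemma for a product of two primitive linear forms: its coefficients
    q s, p s + r q and p r generate the unit ideal, so c is an integral combination of
    its products with them. *)
Lemma sym_content_int (c p q r s : rat) : primitive p q -> primitive r s ->
  p \is a Num.int -> q \is a Num.int -> r \is a Num.int -> s \is a Num.int ->
  c * (q * s) \is a Num.int -> c * (p * s + r * q) \is a Num.int ->
  c * (p * r) \is a Num.int -> c \is a Num.int.
Proof.
move=> [u [v [uZ vZ uv1]]] [u' [v' [uZ' vZ' uv1']]] pZ qZ rZ sZ DZ SZ TZ.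
(* This expands (u p + v q)^2 (u' r + v' s)^2, which is 1, in the ideal. *)
have -> : c =
    (c * (q * s)) * ((v * v') ^+ 2 * (q * s) + 2 * u * v * v' ^+ 2 * (p * s)
      + 2 * u' * v' * v ^+ 2 * (q * r) + 2 * u * v * u' * v' * (p * r)
      - u ^+ 2 * v' ^+ 2 * (p * r) - v ^+ 2 * u' ^+ 2 * (p * r))
    + (c * (p * s + r * q)) * (u ^+ 2 * v' ^+ 2 * (p * s) + v ^+ 2 * u' ^+ 2 * (q * r))
    + (c * (p * r)) * (u ^+ 2 * u' ^+ 2 * (p * r) + 2 * u ^+ 2 * u' * v' * (p * s)
      + 2 * u * v * u' ^+ 2 * (q * r) + 2 * u * v * u' * v' * (q * s)).
  transitivity (c * ((u * p + v * q) * (u' * r + v' * s)) ^+ 2); last by ring.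
  by rewrite uv1 uv1' mulr1 expr1n mulr1.
by int_closed.
Qed.

Lemma sym_height_le (p q r s g N M : rat) : 0 < N -> N * g \is a Num.int -> g != 0 ->
  `|g * (q * s)| <= M -> `|g * (p * s + r * q)| <= M -> `|g * (p * r)| <= M ->
  Num.max `|p| `|q| * Num.max `|r| `|s| <= 2 * (N * M).
Proof.
move=> N0 NgZ g0; have g1 : 0 < `|g| by rewrite normr_gt0.
have Ng1 : 1 <= N * `|g|.
  by rewrite -[N]gtr0_norm // -normrM norm_intr_ge1 // mulf_neq0 // gt_eqF.
move=> b1 b2 b3; have M0 : 0 <= M by exact: le_trans b1.
rewrite !(normrM g) !(mulrC `|g|) -!ler_pdivlMr // in b1 b2 b3.
apply: le_trans (max_mul_le_sym b1 b2 b3) _.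
by rewrite ler_pM2l // ler_pdivrMr // mulrAC ler_peMl.
Qed.

(** Bounds the common factor g of the values A = g p and B = g q of two forms when
    Bezout relations express D X and D Z through A and B with X and Z coprime:
    N D is then an integral multiple of g, where N clears the denominators of the
    cofactors. *)
Lemma bezout_factor_le (g N D X Z p q f1 f2 k1 k2 : rat) :
  0 < N -> D != 0 -> primitive X Z -> p \is a Num.int -> q \is a Num.int ->
  N * f1 \is a Num.int -> N * f2 \is a Num.int ->
  N * k1 \is a Num.int -> N * k2 \is a Num.int ->
  f1 * (g * p) + f2 * (g * q) = D * X -> k1 * (g * p) + k2 * (g * q) = D * Z ->
  `|g| <= N * `|D|.
Proof.
move=> N0 D0 [u [v [uZ vZ uv1]]] pZ qZ f1Z f2Z k1Z k2Z eX eZ.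
have [m mZ gm] : exists2 m, m \is a Num.int & g * m = N * D.
  exists (u * ((N * f1) * p + (N * f2) * q) + v * ((N * k1) * p + (N * k2) * q)).
    by int_closed.
  transitivity (N * (u * (f1 * (g * p) + f2 * (g * q)) + v * (k1 * (g * p) + k2 * (g * q)))).
    by ring.
  by rewrite eX eZ mulrCA [v * _]mulrCA -mulrDr uv1 mulr1.
have m0 : m != 0.
  apply: contra_neq D0 => m0; move/esym/eqP: gm.
  by rewrite m0 mulr0 mulf_eq0 gt_eqF //= => /eqP.
rewrite -[N]gtr0_norm // -normrM -gm normrM.
by rewrite ler_peMr // norm_intr_ge1.
Qed.

(** * The height of P + Q, P - Q and 2P *)

Section HeightBounds.
Variable E : ellcurve rat.
Local Notation xc P := (omap fst (coords P)).
Implicit Types P Q S T : ecpoint E.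

Definition pt_height P := mheight (xc P).

Lemma hcoord_proj P : exists2 d, d != 0 &
  hnum (xc P) = d * proj_x P /\ hden (xc P) = d * proj_z P.
Proof.
rewrite /proj_x /proj_z; case: (coords P) => [[x y]|] /=.
  by exists (denq x)%:~R; rewrite ?intr_eq0 ?denq_neq0 // numqE mulrC mulr1.
by exists 1; rewrite ?oner_eq0 // mulr1 mulr0.
Qed.

Lemma hcoord_sumdiff_rel P Q S T : sumdiff_rel P Q S T -> exists2 g : rat, g != 0 &
  [/\ sumdiff_den (hnum (xc P)) (hden (xc P)) (hnum (xc Q)) (hden (xc Q))
        = g * (hden (xc S) * hden (xc T)),
      sumdiff_sum E (hnum (xc P)) (hden (xc P)) (hnum (xc Q)) (hden (xc Q))
        = g * (hnum (xc S) * hden (xc T) + hnum (xc T) * hden (xc S)) &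
      sumdiff_prod E (hnum (xc P)) (hden (xc P)) (hnum (xc Q)) (hden (xc Q))
        = g * (hnum (xc S) * hnum (xc T))].
Proof.
case=> g g0 [e1 e2 e3].
have [a a0 [-> ->]] := hcoord_proj P; have [b b0 [-> ->]] := hcoord_proj Q.
have [c c0 [-> ->]] := hcoord_proj S; have [d d0 [-> ->]] := hcoord_proj T.
exists ((a * b) ^+ 2 * g / (c * d)).
  by rewrite !mulf_neq0 ?expf_neq0 ?invr_eq0 ?mulf_neq0.
split.
- transitivity ((a * b) ^+ 2 * sumdiff_den (proj_x P) (proj_z P) (proj_x Q) (proj_z Q)).
    by rewrite /sumdiff_den; ring.
  by rewrite e1; field; rewrite c0 d0.
- transitivity ((a * b) ^+ 2 * sumdiff_sum E (proj_x P) (proj_z P) (proj_x Q) (proj_z Q)).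
    by rewrite /sumdiff_sum; ring.
  by rewrite e2; field; rewrite c0 d0.
- transitivity ((a * b) ^+ 2 * sumdiff_prod E (proj_x P) (proj_z P) (proj_x Q) (proj_z Q)).
    by rewrite /sumdiff_prod; ring.
  by rewrite e3; field; rewrite c0 d0.
Qed.

Definition sumdiff_const : rat :=
  4 + `|ec_b2 E| + 2 * `|ec_b4 E| + 2 * `|ec_b6 E| + `|ec_b8 E|.

Lemma sumdiff_bound (x1 z1 x2 z2 A B : rat) :
  `|x1| <= A -> `|z1| <= A -> `|x2| <= B -> `|z2| <= B ->
  [/\ `|sumdiff_den x1 z1 x2 z2| <= sumdiff_const * (A * B) ^+ 2,
      `|sumdiff_sum E x1 z1 x2 z2| <= sumdiff_const * (A * B) ^+ 2 &
      `|sumdiff_prod E x1 z1 x2 z2| <= sumdiff_const * (A * B) ^+ 2].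
Proof.
move=> hx1 hz1 hx2 hz2; set K := A * B.
have mulb (a b c d : rat) : `|a| <= c -> `|b| <= d -> `|a * b| <= c * d.
  by move=> ha hb; rewrite normrM; apply: ler_pM.
have addb (a b c d : rat) : `|a| <= c -> `|b| <= d -> `|a + b| <= c + d.
  by move=> ha hb; apply: le_trans (ler_normD _ _) (lerD ha hb).
have subb (a b c d : rat) : `|a| <= c -> `|b| <= d -> `|a - b| <= c + d.
  by move=> ha hb; apply: addb; rewrite ?normrN.
have hm : `|x1 * x2| <= K by exact: mulb.
have hw : `|z1 * z2| <= K by exact: mulb.
have h12 : `|x1 * z2| <= K by exact: mulb.
have h21 : `|x2 * z1| <= K by rewrite mulrC; exact: mulb.
have hs := addb _ _ _ _ h12 h21; have hd := subb _ _ _ _ h12 h21.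
have K2 : 0 <= K * K by rewrite -expr2 exprn_even_ge0.
have b2 := mulr_ge0 (normr_ge0 (ec_b2 E)) K2.
have b4 := mulr_ge0 (normr_ge0 (ec_b4 E)) K2.
have b6 := mulr_ge0 (normr_ge0 (ec_b6 E)) K2.
have b8 := mulr_ge0 (normr_ge0 (ec_b8 E)) K2.
have self (a : rat) : `|a| <= `|a| by [].
have e2 : `|2 : rat| <= 2 by [].
rewrite /sumdiff_const /sumdiff_den /sumdiff_sum /sumdiff_prod !expr2; split.
- by apply: le_trans (mulb _ _ _ _ hd hd) _; lra.
- apply: le_trans (addb _ _ _ _ (addb _ _ _ _ (addb _ _ _ _
    (mulb _ _ _ _ (mulb _ _ _ _ e2 hm) hs)
    (mulb _ _ _ _ (mulb _ _ _ _ (self _) hm) hw))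
    (mulb _ _ _ _ (mulb _ _ _ _ (self _) hs) hw))
    (mulb _ _ _ _ (self _) (mulb _ _ _ _ hw hw))) _; lra.
- apply: le_trans (subb _ _ _ _ (subb _ _ _ _ (subb _ _ _ _
    (mulb _ _ _ _ hm hm)
    (mulb _ _ _ _ (mulb _ _ _ _ (self _) hm) hw))
    (mulb _ _ _ _ (mulb _ _ _ _ (self _) hs) hw))
    (mulb _ _ _ _ (self _) (mulb _ _ _ _ hw hw))) _; lra.
Qed.

Lemma cubic_bound (c3 c2 c1 c0 x z A : rat) : `|x| <= A -> `|z| <= A ->
  `|cubic c3 c2 c1 c0 x z| <= (`|c3| + `|c2| + `|c1| + `|c0|) * A ^+ 3.
Proof.
move=> hx hz; have A0 : 0 <= A by exact: le_trans hx.
have mon c i j : (i + j = 3)%N -> `|c * x ^+ i * z ^+ j| <= `|c| * A ^+ 3.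
  move=> <-; rewrite !normrM !normrX exprD mulrA.
  by rewrite !ler_pM ?mulr_ge0 ?exprn_ge0 ?lerXn2r ?nnegrE.
rewrite /cubic !mulrDl.
have m3 : `|c3 * x ^+ 3| <= `|c3| * A ^+ 3
  by rewrite -[X in `|X|]mulr1; exact: (mon c3 3 0 erefl).
have m2 : `|c2 * x ^+ 2 * z| <= _ := mon c2 2 1 erefl.
have m1 : `|c1 * x * z ^+ 2| <= _ := mon c1 1 2 erefl.
have m0 : `|c0 * z ^+ 3| <= `|c0| * A ^+ 3.
  by rewrite -[c0 in `|c0 * _|]mulr1; exact: (mon c0 0 3 erefl).
by do 3!(apply: le_trans (ler_normD _ _) _; apply: lerD => //).
Qed.

Lemma cubic_int (c3 c2 c1 c0 x z N : rat) : x \is a Num.int -> z \is a Num.int ->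
  N * c3 \is a Num.int -> N * c2 \is a Num.int -> N * c1 \is a Num.int ->
  N * c0 \is a Num.int -> N * cubic c3 c2 c1 c0 x z \is a Num.int.
Proof.
move=> xZ zZ h3 h2 h1 h0.
have term c u : N * c \is a Num.int -> u \is a Num.int -> N * (c * u) \is a Num.int.
  by move=> hc hu; rewrite mulrA; exact: rpredM.
rewrite /cubic -!mulrA !mulrDr.
by do 3?apply: rpredD; apply: term; rewrite // ?rpredM ?rpredX.
Qed.

Lemma sumdiff_int (N x1 z1 x2 z2 : rat) : N \is a Num.int ->
  N * ec_b2 E \is a Num.int -> N * ec_b4 E \is a Num.int ->
  N * ec_b6 E \is a Num.int -> N * ec_b8 E \is a Num.int ->
  x1 \is a Num.int -> z1 \is a Num.int -> x2 \is a Num.int -> z2 \is a Num.int ->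
  [/\ N * sumdiff_den x1 z1 x2 z2 \is a Num.int, N * sumdiff_sum E x1 z1 x2 z2 \is a Num.int &
      N * sumdiff_prod E x1 z1 x2 z2 \is a Num.int].
Proof.
move=> NZ b2 b4 b6 b8 x1Z z1Z x2Z z2Z.
rewrite /sumdiff_den /sumdiff_sum /sumdiff_prod -!mulrA.
by split; int_closed.
Qed.

(** The forms at (P, Q) have size at most a constant times H(P)^2 H(Q)^2, and dividing
    them by their common factor, which is at least 1/N in absolute value, gives the
    primitive quadratic form attached to P + Q and P - Q. *)
Lemma mheight_sum_diff_le : exists2 C : rat, 0 < C & forall P Q,
  pt_height (P + Q) * pt_height (P - Q) <= C * (pt_height P * pt_height Q) ^+ 2.
Proof.
have [N [N0 NZ hN]] := common_denominator [:: ec_b2 E; ec_b4 E; ec_b6 E; ec_b8 E].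
have c0 : 0 < sumdiff_const.
  have := (normr_ge0 (ec_b2 E), normr_ge0 (ec_b4 E), normr_ge0 (ec_b6 E), normr_ge0 (ec_b8 E)).
  by case=> [[[? ?] ?] ?]; rewrite /sumdiff_const; lra.
exists (2 * N * sumdiff_const) => [|P Q]; first by apply: mulr_gt0 => //; exact: mulr_gt0.
have [g g0 [e1 e2 e3]] := hcoord_sumdiff_rel (sumdiff_relP P Q).
have [b1 b2 b3] := sumdiff_bound (le_hnum_mheight (xc P)) (le_hden_mheight (xc P))
  (le_hnum_mheight (xc Q)) (le_hden_mheight (xc Q)).
have [h2 h4 h6 h8] : [/\ N * ec_b2 E \is a Num.int, N * ec_b4 E \is a Num.int,
    N * ec_b6 E \is a Num.int & N * ec_b8 E \is a Num.int].
  by split; apply: hN; rewrite !inE eqxx ?orbT.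
have [DZ SZ TZ] := sumdiff_int NZ h2 h4 h6 h8 (hnum_int (xc P)) (hden_int (xc P))
  (hnum_int (xc Q)) (hden_int (xc Q)).
rewrite {}e1 in DZ b1; rewrite {}e2 in SZ b2; rewrite {}e3 in TZ b3.
rewrite mulrA in DZ; rewrite mulrA in SZ; rewrite mulrA in TZ.
have NgZ : N * g \is a Num.int.
  exact: (sym_content_int (hcoord_primitive 1 _) (hcoord_primitive 1 _)
    (hnum_int _) (hden_int _) (hnum_int _) (hden_int _) DZ SZ TZ).
rewrite -[2 * N * _]mulrA -[2 * _ * _]mulrA -mulrA.
exact: sym_height_le N0 NgZ g0 b1 b2 b3.
Qed.

Lemma cubic_content_bound (f : rat -> rat -> rat) :
  (exists c3 c2 c1 c0, f = cubic c3 c2 c1 c0) -> exists N M : rat,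
  [/\ 0 < N, N \is a Num.int, 0 <= M,
    (forall x z A, `|x| <= A -> `|z| <= A -> `|f x z| <= M * A ^+ 3) &
    (forall x z, x \is a Num.int -> z \is a Num.int -> N * f x z \is a Num.int)].
Proof.
move=> [c3 [c2 [c1 [c0 ->]]]].
have [N [N0 NZ hN]] := common_denominator [:: c3; c2; c1; c0].
exists N, (`|c3| + `|c2| + `|c1| + `|c0|); split=> [//|//||x z A|x z xZ zZ].
- by do 3?apply: addr_ge0.
- exact: cubic_bound.
- by apply: cubic_int => //; apply: hN; rewrite !inE eqxx ?orbT.
Qed.

(** With S and T the values of the duplication forms, of common factor g, the Bezout
    relations give |Delta| H(P)^7 <= C H(P)^3 max(|S|, |T|) = C H(P)^3 |g| H(2P), and
    |g| is bounded by a multiple of |Delta|. *)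
Lemma mheight_dbl_ge : exists2 C : rat, 0 < C & forall P,
  pt_height P ^+ 4 <= C * pt_height (P + P).
Proof.
have D0 : ec_disc E != 0 by exact: ec_disc_neq0.
suff [N [C [N0 C0 H]]] : exists N C : rat, [/\ 0 < N, 0 < C & forall P, exists g : rat,
    [/\ `|g| <= N * `|ec_disc E| &
      `|ec_disc E| * pt_height P ^+ 7 <= `|g| * (C * pt_height P ^+ 3 * pt_height (P + P))]].
  exists (N * C); first by rewrite mulr_gt0.
  move=> P; have [g [h1 h2]] := H P.
  have h0 : 0 < pt_height P by exact: mheight_gt0.
  have k0 : 0 < `|ec_disc E| * pt_height P ^+ 3 by rewrite mulr_gt0 ?normr_gt0 ?exprn_gt0.
  rewrite -(ler_pM2l k0); have -> : `|ec_disc E| * pt_height P ^+ 3 * pt_height P ^+ 4 =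
      `|ec_disc E| * pt_height P ^+ 7.
    by rewrite -mulrA -exprD.
  apply: le_trans h2 _.
  have -> : `|ec_disc E| * pt_height P ^+ 3 * (N * C * pt_height (P + P)) =
    N * `|ec_disc E| * (C * pt_height P ^+ 3 * pt_height (P + P)) by ring.
  by apply: ler_wpM2r => //; rewrite !mulr_ge0 ?exprn_ge0 ?(ltW C0) // ltW // mheight_gt0.
have [|N1 [M1 [N10 NZ1 M10 b1 i1]]] :=
  @cubic_content_bound (dup_cofactor_zT E); first by do 4!eexists.
have [|N2 [M2 [N20 NZ2 M20 b2 i2]]] :=
  @cubic_content_bound (dup_cofactor_zS E); first by do 4!eexists.
have [|N3 [M3 [N30 NZ3 M30 b3 i3]]] :=
  @cubic_content_bound (dup_cofactor_xT E); first by do 4!eexists.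
have [|N4 [M4 [N40 NZ4 M40 b4 i4]]] :=
  @cubic_content_bound (dup_cofactor_xS E); first by do 4!eexists.
exists (N1 * N2 * N3 * N4), (1 + M1 + M2 + M3 + M4); split.
- by rewrite !mulr_gt0.
- by lra.
move=> P; have [g g0 [_ e2 e3]] := hcoord_sumdiff_rel (sumdiff_rel_dbl P).
have z0 : hden (xc (0 : ecpoint E)) = 0 by [].
have x0 : hnum (xc (0 : ecpoint E)) = 1 by [].
rewrite {}z0 {}x0 mulr0 add0r mul1r mulr1 in e2 e3.
have ex := dup_bezout_x E (hnum (xc P)) (hden (xc P)).
have ez := dup_bezout_z E (hnum (xc P)) (hden (xc P)).
rewrite {}e2 {}e3 in ex ez.
have i1' := i1 _ _ (hnum_int (xc P)) (hden_int (xc P)).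
have i2' := i2 _ _ (hnum_int (xc P)) (hden_int (xc P)).
have i3' := i3 _ _ (hnum_int (xc P)) (hden_int (xc P)).
have i4' := i4 _ _ (hnum_int (xc P)) (hden_int (xc P)).
have b1' := b1 _ _ _ (le_hnum_mheight (xc P)) (le_hden_mheight (xc P)).
have b2' := b2 _ _ _ (le_hnum_mheight (xc P)) (le_hden_mheight (xc P)).
have b3' := b3 _ _ _ (le_hnum_mheight (xc P)) (le_hden_mheight (xc P)).
have b4' := b4 _ _ _ (le_hnum_mheight (xc P)) (le_hden_mheight (xc P)).
have pZ := hnum_int (xc (P + P)); have qZ := hden_int (xc (P + P)).
have pH := le_hnum_mheight (xc (P + P)); have qH := le_hden_mheight (xc (P + P)).
rewrite -/(pt_height P) -/(pt_height (P + P)) in b1' b2' b3' b4' pH qH.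
exists g; split.
- apply: (bezout_factor_le _ D0 (hcoord_primitive 7 (xc P)) pZ qZ _ _ _ _ ex ez).
  + by rewrite !mulr_gt0.
  + by rewrite (_ : _ * N4 = N1 * N2 * N4 * N3) -?mulrA; [int_closed | ring].
  + by rewrite -!mulrA; int_closed.
  + by rewrite (_ : _ * N4 = N2 * N3 * N4 * N1) -?mulrA; [int_closed | ring].
  + by rewrite (_ : _ * N4 = N1 * N3 * N4 * N2) -?mulrA; [int_closed | ring].
- have h3 : 0 <= pt_height P ^+ 3 by rewrite exprn_ge0 // ltW // mheight_gt0.
  have hh : 0 <= pt_height (P + P) by rewrite ltW // mheight_gt0.
  have key (a b Ma Mb w : rat) :
      `|a| <= Ma * pt_height P ^+ 3 -> `|b| <= Mb * pt_height P ^+ 3 ->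
      0 <= Ma -> 0 <= Mb -> Ma + Mb <= 1 + M1 + M2 + M3 + M4 ->
      a * (g * hnum (xc (P + P))) + b * (g * hden (xc (P + P))) = ec_disc E * w ->
      `|ec_disc E * w| <=
        `|g| * ((1 + M1 + M2 + M3 + M4) * pt_height P ^+ 3 * pt_height (P + P)).
    move=> ha hb Ma0 Mb0 hM <-.
    rewrite !(mulrCA _ g) -mulrDr normrM ler_wpM2l //.
    apply: le_trans (ler_normD _ _) _; rewrite !normrM.
    apply: (@le_trans _ _ ((Ma + Mb) * pt_height P ^+ 3 * pt_height (P + P))).
      by rewrite !mulrDl lerD // ler_pM.
    by rewrite ler_wpM2r // ler_wpM2r.
  have -> : `|ec_disc E| * pt_height P ^+ 7 =
      Num.max `|ec_disc E * hnum (xc P) ^+ 7| `|ec_disc E * hden (xc P) ^+ 7|.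
    exact: norm_mul_max_exp.
  rewrite ge_max; apply/andP; split.
  + by apply: (key _ _ _ _ _ b3' b4' M30 M40 _ ex); clear -M10 M20 M30 M40; lra.
  + by apply: (key _ _ _ _ _ b1' b2' M10 M20 _ ez); clear -M10 M20 M30 M40; lra.
Qed.
End HeightBounds.

(** * Quadratic forms and Tate's limit *)

Section Polar.
Variables (R : realFieldType) (G : zmodType) (q : G -> R).
Hypothesis qP : forall x y, q (x + y) + q (x - y) = 2 * q x + 2 * q y.

Definition polar (x y : G) : R := 2^-1 * (q (x + y) - q x - q y).

Lemma polarC x y : polar x y = polar y x.
Proof. by rewrite /polar [y + x]addrC addrAC. Qed.

Lemma parallelogram0 : q 0 = 0.
Proof. by have := qP 0 0; rewrite addr0 subr0; lra. Qed.

Lemma polar_diag x : polar x x = q x.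
Proof.
have := qP x x; have := parallelogram0; rewrite /polar subrr; lra.
Qed.

(** Combining the parallelogram law for the pairs (x + z, y), (y + z, x) and
    (z, x - y) cancels the terms in x + z - y and y + z - x. *)
Lemma polarDl x y z : polar (x + y) z = polar x z + polar y z.
Proof.
have e1 := qP (x + z) y; have e2 := qP (y + z) x.
have e3 := qP z (x - y); have e4 := qP x y.
rewrite [y + z + x]addrC addrA [x + z + y]addrAC in e1 e2.
have e : y + z - x = z - (x - y) by rewrite opprB addrCA addrA addrAC.
have e' : x + z - y = z + (x - y) by rewrite addrCA addrA.
rewrite e e' in e1 e2; rewrite /polar; lra.
Qed.

End Polar.

Section QuasiQuadratic.
Variables (R : realType) (G : zmodType) (h : G -> R) (C : R).
Hypothesis h_ge0 : forall x, 0 <= h x.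
Hypothesis h_upper : forall x y, h (x + y) + h (x - y) <= 2 * h x + 2 * h y + C.
Hypothesis h_lower : forall x, 4 * h x <= h (x + x) + C.

(** The limit of 4^-n h(2^n x).  Its consecutive terms differ by at most
    C / 4^(n+1), so adding or subtracting C / (3 * 4^n) makes the sequence monotone;
    convergence and the comparison with h follow from monotonicity. *)
Definition tate_seq (x : G) (n : nat) : R := 4 ^- n * h (x *+ 2 ^ n).
Definition tate_lim (x : G) : R := limn (tate_seq x).

Lemma tate_seq_step x n : `|tate_seq x n.+1 - tate_seq x n| <= 4 ^- n.+1 * C.
Proof.
have -> : tate_seq x n.+1 - tate_seq x n =
    4 ^- n.+1 * (h (x *+ 2 ^ n + x *+ 2 ^ n) - 4 * h (x *+ 2 ^ n)).
  rewrite /tate_seq -mulrnDr addnn -mul2n -expnS mulrBr mulrA; congr (_ - _ * _).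
  by rewrite exprS; field.
rewrite normrM ger0_norm ?invr_ge0 ?exprn_ge0 //.
rewrite ler_wpM2l ?invr_ge0 ?exprn_ge0 // ler_norml.
have := h_lower (x *+ 2 ^ n); have := h_upper (x *+ 2 ^ n) (x *+ 2 ^ n).
have := h_ge0 (x *+ 2 ^ n - x *+ 2 ^ n); move=> *; apply/andP; split; lra.
Qed.

Lemma pow4_step n : C / 3 * 4 ^- n = C / 3 * 4 ^- n.+1 + 4 ^- n.+1 * C.
Proof. by rewrite exprS; field; rewrite expf_neq0. Qed.

Lemma tate_nonincreasing x : nonincreasing_seq (fun n => tate_seq x n + C / 3 * 4 ^- n).
Proof.
apply/nonincreasing_seqP => n; rewrite (pow4_step n).
by have := tate_seq_step x n; rewrite ler_norml => /andP[]; lra.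
Qed.

Lemma tate_nondecreasing x : nondecreasing_seq (fun n => tate_seq x n - C / 3 * 4 ^- n).
Proof.
apply/nondecreasing_seqP => n; rewrite (pow4_step n).
by have := tate_seq_step x n; rewrite ler_norml => /andP[]; lra.
Qed.

Lemma tate_seq_ge0 x n : 0 <= tate_seq x n.
Proof. by rewrite mulr_ge0 ?invr_ge0 ?exprn_ge0. Qed.

Lemma defect_ge0 : 0 <= C.
Proof.
have := h_ge0 0; have := h_upper 0 0; have := h_lower 0; rewrite subr0 addr0; lra.
Qed.

Lemma pow4_cvg0 : C / 3 * 4 ^- n @[n --> \oo] --> (0 : R).
Proof.
rewrite -(mulr0 (C / 3)); apply: cvgMr.
under eq_fun do rewrite -exprVn.
apply: cvg_expr; rewrite ger0_norm ?invr_ge0 // invf_lt1 //; lra.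
Qed.

Lemma tate_cvg x : tate_seq x @ \oo --> tate_lim x.
Proof.
suff : cvgn (tate_seq x) by [].
have cb : cvgn (fun n => tate_seq x n + C / 3 * 4 ^- n).
  apply: nonincreasing_is_cvgn; first exact: tate_nonincreasing.
  exists 0 => _ [n _ <-]; rewrite addr_ge0 ?tate_seq_ge0 //.
  by rewrite mulr_ge0 ?invr_ge0 ?exprn_ge0 ?divr_ge0 ?defect_ge0.
have -> : tate_seq x = (fun n => tate_seq x n + C / 3 * 4 ^- n) \- (fun n => C / 3 * 4 ^- n).
  by apply/funext => n /=; rewrite addrK.
by apply: is_cvgB => //; apply/cvg_ex; exists 0; exact: pow4_cvg0.
Qed.

Lemma tate_ge x : h x - C / 3 <= tate_lim x.
Proof.
have cb : (fun n => tate_seq x n - C / 3 * 4 ^- n) @ \oo --> tate_lim x - 0.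
  by apply: cvgB; [exact: tate_cvg | exact: pow4_cvg0].
rewrite subr0 in cb; rewrite -(cvg_lim _ cb) //.
have -> : h x - C / 3 = tate_seq x 0 - C / 3 * 4 ^- 0.
  by rewrite /tate_seq expn0 expr0 invr1 mul1r mulr1.
apply: nondecreasing_cvgn_le; [exact: tate_nondecreasing | by apply/cvg_ex; eexists; exact: cb].
Qed.

Lemma tate_ge0 x : 0 <= tate_lim x.
Proof.
apply: limr_ge; first exact: tate_cvg.
by apply: nearW => n; exact: tate_seq_ge0.
Qed.

Lemma tate_dbl x : tate_lim (x + x) = 4 * tate_lim x.
Proof.
apply: (cvg_lim _) => //.
have -> : tate_seq (x + x) = (fun n => 4 * tate_seq x n.+1).
  apply/funext => n; rewrite /tate_seq -mulr2n -mulrnA -expnS exprS; field.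
  by rewrite expf_neq0.
apply: cvgMr.
by have := @cvg_shiftS _ (tate_seq x) (nbhs (tate_lim x)) => ->; exact: tate_cvg.
Qed.

Lemma tate_upper x y : tate_lim (x + y) + tate_lim (x - y) <= 2 * tate_lim x + 2 * tate_lim y.
Proof.
have cl : (fun n => tate_seq (x + y) n + tate_seq (x - y) n) @ \oo -->
    tate_lim (x + y) + tate_lim (x - y) by apply: cvgD; exact: tate_cvg.
have cr : (fun n => 2 * tate_seq x n + 2 * tate_seq y n + 3 * (C / 3 * 4 ^- n)) @ \oo -->
    2 * tate_lim x + 2 * tate_lim y + 3 * 0.
  apply: cvgD; last by apply: cvgMr; exact: pow4_cvg0.
  by apply: cvgD; apply: cvgMr; exact: tate_cvg.
(* The last term is 4^-n C, written so that its limit is already known. *)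
rewrite mulr0 addr0 in cr; apply: ler_cvg_to cl cr _.
apply: nearW => n; rewrite /tate_seq mulrnBl mulrnDl.
have -> : 3 * (C / 3 * 4 ^- n) = 4 ^- n * C by field; rewrite expf_neq0.
rewrite !(mulrCA 2) -!mulrDr ler_wpM2l ?invr_ge0 ?exprn_ge0 //; rewrite mulrDr; exact: h_upper.
Qed.

(** The inequality for (x + y, x - y), whose sum and difference are 2x and 2y, is the
    reverse of the inequality for (x, y), as the limit is multiplied by 4 under
    doubling. *)
Lemma tate_parallelogram x y :
  tate_lim (x + y) + tate_lim (x - y) = 2 * tate_lim x + 2 * tate_lim y.
Proof.
apply/eqP; rewrite eq_le tate_upper /=.
have := tate_upper (x + y) (x - y).
have -> : x + y + (x - y) = x + x by rewrite addrACA subrr addr0.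
have -> : x + y - (x - y) = y + y by rewrite opprB [x + y]addrC addrACA subrr addr0.
rewrite !tate_dbl; lra.
Qed.
End QuasiQuadratic.

(** * Points of bounded height *)

Section Northcott.
Variable E : ellcurve rat.

Lemma finite_x_fibres (xs : seq (option rat)) :
  exists s : seq (ecpoint E), forall P, x_coord P \in xs -> P \in s.
Proof.
elim: xs => [|x xs [s sP]]; first by exists [::].
have [[P0 <-]|nex] := EM (exists P0 : ecpoint E, x_coord P0 = x).
  exists [:: P0, - P0 & s] => P; rewrite !inE => /orP[/eqP eP|/sP ->]; last by rewrite !orbT.
  move: eP; rewrite /x_coord; case cP: (coords P) => [[x1 y1]|];
    case cP0: (coords P0) => [[x0 y0]|] //=.
    case=> ex; subst x1.
    have h : ec_on_curve E (Some (x0, y1)) by rewrite -cP; exact: coordsP.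
    have h0 : ec_on_curve E (Some (x0, y0)) by rewrite -cP0; exact: coordsP.
    case: (ec_same_x h h0) => ey; apply/orP; [left|right; apply/orP; left];
      apply/eqP/val_inj; rewrite /= cP ?cP0 ey //.
  by move=> _; apply/orP; left; apply/eqP/val_inj; rewrite /= cP cP0.
exists s => P; rewrite inE => /orP[/eqP eP|/sP //].
by case: nex; exists P.
Qed.

Lemma bounded_mheight_finite (n : nat) :
  exists s : seq (ecpoint E), forall P, mheight (x_coord P) <= n%:R -> P \in s.
Proof.
pose ints : seq int := [seq k%:Z - n%:Z | k <- iota 0 (2 * n).+1].
have intsP (i : int) : `|i%:~R : rat| <= n%:R -> i \in ints.
  rewrite -intr_norm -[n%:R]/(n%:~R) ler_int => hi.
  apply/mapP; exists (absz (i + n%:Z)); last by lia.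
  by rewrite mem_iota; lia.
clearbody ints; have [s sP] := finite_x_fibres
  (None :: [seq Some (i%:~R / j%:~R : rat) | i <- ints, j <- ints]).
exists s => P leP; apply: sP; rewrite inE.
have h1 := le_trans (le_hnum_mheight _) leP; have h2 := le_trans (le_hden_mheight _) leP.
case: (x_coord P) h1 h2 => [q|] //= /intsP h1 /intsP h2.
by apply/allpairsP; exists (numq q, denq q); rewrite /= divq_num_den.
Qed.
End Northcott.

(** * The canonical height and the pairing *)

Section CanonicalHeight.
Variables (R : realType) (E : ellcurve rat).
Implicit Types P Q : ecpoint E.

Definition naive_height P : R := weil_height R (x_coord P).

Lemma naive_heightE P : naive_height P = ln (ratr (mheight (x_coord P))).
Proof.
rewrite /naive_height /weil_height /mheight.
case: (x_coord P) => [q|] /=; last by rewrite normr1 normr0 max_l // rmorph1 ln1.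
have rat_max (a b : rat) : ratr (Num.max a b) = Num.max (ratr a) (ratr b) :> R.
  by rewrite !maxEle ler_rat; case: ifP.
by rewrite rat_max !ratr_norm !ratr_int.
Qed.

Lemma naive_height_ge0 P : 0 <= naive_height P.
Proof. by rewrite naive_heightE ln_ge0 // -(rmorph1 (@ratr R)) ler_rat mheight_ge1. Qed.

Lemma ratr_height_gt0 P : 0 < ratr (pt_height P) :> R.
Proof. by rewrite -(rmorph0 (@ratr R)) ltr_rat mheight_gt0. Qed.

Lemma naive_height_quasi_quadratic : exists C : R,
  (forall P Q, naive_height (P + Q) + naive_height (P - Q)
     <= 2 * naive_height P + 2 * naive_height Q + C) /\
  (forall P, 4 * naive_height P <= naive_height (P + P) + C).
Proof.
have [C1 C10 h1] := mheight_sum_diff_le E; have [C2 C20 h2] := mheight_dbl_ge E.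
have pos (c : rat) : 0 < c -> 0 < (ratr c : R).
  by move=> c0; rewrite -(rmorph0 (@ratr R)) ltr_rat.
have up (a b c d e : R) : 0 < a -> 0 < b -> 0 < c -> 0 < d -> 0 < e ->
    a * b <= c * (d * e) ^+ 2 -> ln a + ln b <= 2 * ln d + 2 * ln e + ln c.
  move=> a0 b0 c0 d0 e0 le; have de0 : 0 < d * e by rewrite mulr_gt0.
  have r0 : 0 < c * (d * e) ^+ 2 by rewrite mulr_gt0 ?exprn_gt0.
  move: le; rewrite -ler_ln ?posrE ?mulr_gt0 //.
  by rewrite [ln (c * _)]lnM ?lnXn ?lnM ?posrE ?exprn_gt0 // -mulr_natl; lra.
have low (a b c : R) : 0 < a -> 0 < b -> 0 < c ->
    a ^+ 4 <= c * b -> 4 * ln a <= ln b + ln c.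
  move=> a0 b0 c0 le; have cb0 : 0 < c * b by rewrite mulr_gt0.
  move: le; rewrite -ler_ln ?posrE ?exprn_gt0 //.
  by rewrite lnXn // lnM ?posrE // -mulr_natl; lra.
exists (Num.max (ln (ratr C1)) (ln (ratr C2))); split=> [P Q|P].
  have := h1 P Q; rewrite -(ler_rat R) !(rmorphM, rmorphXn) /=.
  move/(up _ _ _ _ _ (ratr_height_gt0 _) (ratr_height_gt0 _) (pos _ C10)
    (ratr_height_gt0 _) (ratr_height_gt0 _)).
  rewrite !naive_heightE => /le_trans; apply; rewrite lerD2l le_max lexx //.
have := h2 P; rewrite -(ler_rat R) !(rmorphM, rmorphXn) /=.
move/(low _ _ _ (ratr_height_gt0 _) (ratr_height_gt0 _) (pos _ C20)).
by rewrite !naive_heightE => /le_trans; apply; rewrite lerD2l le_max lexx orbT.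
Qed.

Lemma canonical_height_parallelogram P Q :
  canonical_height R (P + Q) + canonical_height R (P - Q)
  = 2 * canonical_height R P + 2 * canonical_height R Q.
Proof.
have [C [h1 h2]] := naive_height_quasi_quadratic.
exact: tate_parallelogram naive_height_ge0 h1 h2 P Q.
Qed.

Lemma canonical_height_ge0 P : 0 <= canonical_height R P.
Proof.
have [C [h1 h2]] := naive_height_quasi_quadratic.
exact: tate_ge0 naive_height_ge0 h1 h2 P.
Qed.

Lemma height_pairingC P Q : height_pairing R P Q = height_pairing R Q P.
Proof. exact: polarC. Qed.

Lemma height_pairingDl P Q S :
  height_pairing R (P + Q) S = height_pairing R P S + height_pairing R Q S.
Proof. exact: (polarDl canonical_height_parallelogram). Qed.

Lemma height_pairingPP P : height_pairing R P P = canonical_height R P.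
Proof. exact: (polar_diag canonical_height_parallelogram). Qed.

Lemma height_pairingMnl P Q n : height_pairing R (P *+ n) Q = height_pairing R P Q *+ n.
Proof.
elim: n => [|n IH]; last by rewrite !mulrSr height_pairingDl IH.
rewrite !mulr0n; apply: (@addIr _ (height_pairing R 0 Q)).
by rewrite -height_pairingDl addr0 add0r.
Qed.

Lemma canonical_heightMn P n : canonical_height R (P *+ n) = n%:R ^+ 2 * canonical_height R P.
Proof.
rewrite -!height_pairingPP height_pairingMnl height_pairingC height_pairingMnl.
by rewrite -mulrnA -[LHS]mulr_natl natrM expr2.
Qed.

Lemma bounded_naive_height_finite (B : R) :
  exists s : seq (ecpoint E), forall P, naive_height P <= B -> P \in s.
Proof.
have [s sP] := bounded_mheight_finite E (Num.truncn (expR B)).+1.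
exists s => P leP; apply: sP; rewrite -(ler_rat R) ratr_nat.
apply/ltW/(le_lt_trans _ (truncnS_gt _)).
by rewrite -[X in X <= _]lnK ?posrE ?ratr_height_gt0 // ler_expR -naive_heightE.
Qed.

(** Let s list the points of naive height at most 1 + C/3.  If the canonical height of
    P is less than 1/(|s| + 1)^2, then kP has canonical height at most 1, hence lies
    in s, for the |s| + 1 values k <= |s|; two of these multiples coincide and P is
    torsion. *)
Lemma canonical_height_gap : exists2 l : R, 0 < l &
  forall P, P \notin @torsion (ecpoint E) -> l <= canonical_height R P.
Proof.
have [C [h1 h2]] := naive_height_quasi_quadratic.
have [s sP] := bounded_naive_height_finite (1 + C / 3).
exists ((size s).+1%:R ^- 2) => [|P ntP]; first by rewrite invr_gt0 exprn_gt0.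
rewrite leNgt; apply/negP => small.
have inj : injective (fun k => P *+ k).
  have aux i j : (i < j)%N -> P *+ i <> P *+ j.
    move=> ij e; case/negP: ntP; apply/asboolP; exists (j - i)%N; first by rewrite subn_gt0.
    by rewrite mulrnBr ?(ltnW ij) // e subrr.
  move=> i j e; case: (ltngtP i j) => // [/aux //|/aux ne]; by case: ne.
pose t := [seq P *+ k | k <- iota 0 (size s).+1].
have ut : uniq t by rewrite map_inj_uniq ?iota_uniq.
suff /(uniq_leq_size ut) : {subset t <= s} by rewrite size_map size_iota ltnn.
move=> y /mapP[k]; rewrite mem_iota add0n => /andP[_ hk] ->; apply: sP.
have : naive_height (P *+ k) - C / 3 <= canonical_height R (P *+ k) :=
  tate_ge naive_height_ge0 h1 h2 _.
suff : canonical_height R (P *+ k) <= 1 by lra.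
rewrite canonical_heightMn.
apply: le_trans (ler_wpM2l _ (ltW small)) _; first by rewrite exprn_ge0.
by rewrite ler_pdivrMr ?exprn_gt0 // mul1r lerXn2r ?nnegrE // ler_nat ltnW.
Qed.

Local Notation MW := (mordell_weil E).

(** If n P = 0 with n > 0, then n <P, Q> = 0 by additivity. *)
Lemma height_pairing_torsion P Q : P \in @torsion (ecpoint E) -> height_pairing R P Q = 0.
Proof.
move=> /asboolP[n n0 Pn]; have := height_pairingMnl P Q n.
have := height_pairingMnl P Q 0; rewrite Pn mulr0n => -> /esym/eqP.
by rewrite mulrn_eq0 => /orP[/eqP e|/eqP //]; rewrite e in n0.
Qed.

Lemma height_pairing_quot P P' Q :
  \pi_MW P = \pi_MW P' -> height_pairing R P Q = height_pairing R P' Q.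
Proof.
move/eqP; rewrite -[_ == _]Quotient.idealrBE => h.
by rewrite -[P](subrK P') height_pairingDl height_pairing_torsion ?add0r.
Qed.

Lemma mw_pairing_pi P Q : mw_pairing R (\pi_MW P) (\pi_MW Q) = height_pairing R P Q.
Proof.
rewrite /mw_pairing (height_pairing_quot _ (reprK _)) height_pairingC.
by rewrite (height_pairing_quot _ (reprK _)) height_pairingC.
Qed.

Lemma mw_pairingC (m n : MW) : mw_pairing R m n = mw_pairing R n m.
Proof. exact: height_pairingC. Qed.

Lemma mw_pairingDl (m n p : MW) : mw_pairing R (m + n) p = mw_pairing R m p + mw_pairing R n p.
Proof.
rewrite -[m]reprK -[n]reprK -[p]reprK -raddfD !mw_pairing_pi; exact: height_pairingDl.
Qed.

Lemma mw_pairing_ge0 (m : MW) : 0 <= mw_pairing R m m.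
Proof. by rewrite /mw_pairing height_pairingPP canonical_height_ge0. Qed.

Lemma mw_pairing_gap : exists2 l : R, 0 < l & forall m : MW, m != 0 -> l <= mw_pairing R m m.
Proof.
have [l l0 hl] := canonical_height_gap; exists l => // m m0.
rewrite /mw_pairing height_pairingPP; apply: hl; apply: contra m0 => h.
by rewrite -[m]reprK -(raddf0 (\pi_MW)) -[_ == _]Quotient.idealrBE subr0.
Qed.
End CanonicalHeight.

(** * Linear maps and bilinear forms on a tensor product *)

Section TensorLift.
Variables (R : nzRingType) (M : zmodType) (L : lmodType R) (g : M -> L).
Hypothesis gD : {morph g : m n / m + n}.

(** The R-linear extension of an additive map.  Being computed on a representative, it
    has the shape of [tensor_form], which becomes an iterated extension
    ([tensor_formE]). *)
Definition tensor_lift (v : tensor R M) : L :=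
  \sum_(m <- dom (repr v)) coeff m (repr v) *: g m.

HB.instance Definition _ := GRing.isZmodMorphism.Build {freeg M / R} L (fglift g)
  (lift_is_additive g).

Lemma fglift_sum (D : {freeg M / R}) :
  fglift g D = \sum_(m <- dom D) coeff m D *: g m.
Proof.
rewrite -{1}(freeg_sumE D) raddf_sum.
by apply: eq_bigr => m _; rewrite /= liftU.
Qed.

Lemma fgliftZ a (D : {freeg M / R}) : fglift g (a *: D) = a *: fglift g D.
Proof.
rewrite [in RHS]fglift_sum scaler_sumr.
have -> : a *: D = \sum_(m <- dom D) << a * coeff m D *g m >> by [].
rewrite raddf_sum.
by apply: eq_bigr => m _; rewrite /= liftU scalerA.
Qed.

Lemma fglift_relation D : tensor_relation D -> fglift g D = 0.
Proof.
elim=> [|a m n D' _ IH]; first exact: raddf0.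
rewrite raddfD /= IH addr0 fgliftZ.
have -> : fglift g (<< m + n >> - << m >> - << n >>) = 0.
  by rewrite !raddfB /= !liftU !scale1r gD -addrA -opprD subrr.
exact: scaler0.
Qed.

Lemma tensor_lift_pi D : tensor_lift (\pi_(tensor R M) D) = fglift g D.
Proof.
rewrite /tensor_lift -fglift_sum; apply/eqP; rewrite -subr_eq0 -raddfB; apply/eqP.
apply: fglift_relation; apply/asboolP.
rewrite -[X in is_true X]/(repr (\pi_(tensor R M) D) - D \in @tensor_rel R M).
by rewrite Quotient.idealrBE reprK.
Qed.

Lemma tensor_liftD : {morph tensor_lift : v w / v + w}.
Proof.
by move=> v w; rewrite -[v]reprK -[w]reprK -raddfD !tensor_lift_pi raddfD.
Qed.

Lemma tensor_liftZ a v : tensor_lift (a *: v) = a *: tensor_lift v.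
Proof.
rewrite -[v]reprK; have -> : a *: \pi_(tensor R M) (repr v) = \pi_(tensor R M) (a *: repr v).
  exact: tensor_scale_pi.
by rewrite !tensor_lift_pi fgliftZ.
Qed.

Lemma tensor_lift_of m : tensor_lift (tensor_of R m) = g m.
Proof. by rewrite tensor_lift_pi liftU scale1r. Qed.
End TensorLift.

Lemma tensor_ind (R : nzRingType) (M : zmodType) (K : tensor R M -> Prop) :
  (forall v w, K v -> K w -> K (v + w)) -> (forall a v, K v -> K (a *: v)) ->
  (forall m, K (tensor_of R m)) -> forall v, K v.
Proof.
move=> KD KZ Kof v; rewrite -[v]reprK -(freeg_sumE (repr v)) raddf_sum.
have K0 : K 0 by rewrite -(scale0r (tensor_of R 0)); exact: KZ.
apply: big_ind => // m _.
have -> : << coeff m (repr v) *g m >> = coeff m (repr v) *: << m >> :> {freeg M / R}.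
  by apply/eqP/freeg_eqP => x; rewrite coeffZ !coeffU mul1r.
have := KZ (coeff m (repr v)) _ (Kof m).
by rewrite [_ *: tensor_of R m]tensor_scale_pi.
Qed.

Section TensorForm.
Variables (R : comNzRingType) (M : zmodType) (b : M -> M -> R).
Hypothesis bC : forall m n, b m n = b n m.
Hypothesis bD : forall m n p, b (m + n) p = b m p + b n p.

Lemma tensor_formE v w :
  tensor_form b v w = tensor_lift (fun m => tensor_lift (b m : M -> R^o) w : R^o) v.
Proof.
apply: eq_bigr => m _; rewrite scaler_sumr; apply: eq_bigr => n _.
by rewrite -mulrA.
Qed.

Lemma tensor_formC v w : tensor_form b v w = tensor_form b w v.
Proof.
rewrite /tensor_form exchange_big /=; apply: eq_bigr => m _; apply: eq_bigr => n _.
by rewrite bC [coeff n _ * _]mulrC.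
Qed.

Lemma tensor_formDl v v' w : tensor_form b (v + v') w = tensor_form b v w + tensor_form b v' w.
Proof.
rewrite !tensor_formE tensor_liftD // => m n.
by rewrite -big_split; apply: eq_bigr => p _; rewrite bD scalerDr.
Qed.

Lemma tensor_formZl a v w : tensor_form b (a *: v) w = a * tensor_form b v w.
Proof.
rewrite !tensor_formE tensor_liftZ // => m n.
by rewrite -big_split; apply: eq_bigr => p _; rewrite bD scalerDr.
Qed.

Lemma tensor_form_of m n : tensor_form b (tensor_of R m) (tensor_of R n) = b m n.
Proof.
have bDr p : {morph b p : x y / x + y} by move=> x y; rewrite ![b p _]bC bD.
rewrite tensor_formE tensor_lift_of ?tensor_lift_of // => x y.
by rewrite -big_split; apply: eq_bigr => p _; rewrite bD scalerDr.
Qed.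

Lemma tensor_formDr v w w' : tensor_form b v (w + w') = tensor_form b v w + tensor_form b v w'.
Proof. by rewrite tensor_formC tensor_formDl; congr (_ + _); exact: tensor_formC. Qed.

Lemma tensor_formZr a v w : tensor_form b v (a *: w) = a * tensor_form b v w.
Proof. by rewrite tensor_formC tensor_formZl; congr (_ * _); exact: tensor_formC. Qed.
End TensorForm.

(** * Lengths of closed geodesics *)

Section Torus.
Variables (R : realType) (E : ellcurve rat).
Local Notation MW := (mordell_weil E).
Local Notation HS := (height_space R E).
Local Notation HT := (height_torus R E).
Local Notation b := (@mw_pairing R E).
Local Notation inner := (@height_inner R E).
Implicit Types (v w : HS) (m n l : MW).

Let bC := @mw_pairingC R E.
Let bD := @mw_pairingDl R E.

Lemma mw_pairing0l m : b 0 m = 0.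
Proof. by apply: (@addIr _ (b 0 m)); rewrite -bD !add0r. Qed.

Lemma mw_pairingNl m n : b (- m) n = - b m n.
Proof. by apply/eqP; rewrite -addr_eq0 -bD addNr mw_pairing0l. Qed.

Lemma mw_pairingMnl m n k : b (m *+ k) n = k%:R * b m n.
Proof.
elim: k => [|k IH]; first by rewrite !mulr0n mw_pairing0l mul0r.
by rewrite mulrSr bD IH mulrSr mulrDl mul1r.
Qed.

Definition lattice_norm m : R := Num.sqrt (b m m).

Lemma inner_segment a m l :
  inner (a *: tensor_of R m + tensor_of R l) (a *: tensor_of R m + tensor_of R l)
  = a ^+ 2 * b m m + 2 * a * b m l + b l l.
Proof.
rewrite /height_inner (tensor_formDl bD) !(tensor_formDr bC bD).
rewrite !(tensor_formZl bD) !(tensor_formZr bC bD) !(tensor_form_of bC bD) [b l m]bC; ring.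
Qed.

Lemma height_torus_eqP v w :
  \pi_HT v = \pi_HT w <-> exists l : MW, v = w + tensor_of R l.
Proof.
split.
  move/eqP; rewrite -[_ == _]Quotient.idealrBE => /asboolP[l e].
  by exists l; rewrite -e addrC subrK.
case=> l ->; apply/eqP; rewrite -[_ == _]Quotient.idealrBE; apply/asboolP.
by exists l; rewrite addrC addKr.
Qed.

Lemma torus_dist_lb (x y : HT) (d : R) :
  (forall v w : HS, \pi_HT v = x -> \pi_HT w = y -> d <= height_norm (v - w)) ->
  d <= torus_dist x y.
Proof.
move=> h; apply: lb_le_inf.
  by exists (height_norm (repr x - repr y)); exists (repr x), (repr y); rewrite !reprK.
by move=> _ [v [w [hv hw ->]]]; exact: h.
Qed.

Lemma torus_dist_ub v w : torus_dist (\pi_HT v) (\pi_HT w) <= height_norm (v - w).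
Proof.
apply: ge_inf; last by exists v, w.
by exists 0 => _ [v' [w' [_ _ ->]]]; exact: sqrtr_ge0.
Qed.

Lemma inner_scale_of a m :
  inner (a *: tensor_of R m) (a *: tensor_of R m) = a ^+ 2 * b m m.
Proof.
by rewrite /height_inner (tensor_formZl bD) (tensor_formZr bC bD) (tensor_form_of bC bD) mulrA.
Qed.

Lemma norm_scale_of a m : height_norm (a *: tensor_of R m : HS) = `|a| * lattice_norm m.
Proof. by rewrite /height_norm inner_scale_of sqrtrM ?sqr_ge0 // sqrtr_sqr. Qed.

Lemma geodesic_dist_le m s t :
  torus_dist (closed_geodesic m s) (closed_geodesic m t) <= `|s - t| * lattice_norm m.
Proof.
apply: le_trans (torus_dist_ub _ _) _.
by rewrite -scalerBl norm_scale_of.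
Qed.

(** Let g be a lower bound of <l, l> over nonzero l, and k an integer with
    <m, m> <= k^2 g.  Positivity at m + k l and m - k l gives
    2 k |<m, l>| <= <m, m> + k^2 <l, l> <= 2 k^2 <l, l>, so that d = 1 / (2 k) works. *)
Lemma mw_pairing_segment_ge m : exists2 d : R, 0 < d & forall a l, `|a| <= d -> l != 0 ->
  0 <= 2 * a * b m l + b l l.
Proof.
have [g g0 hg] := mw_pairing_gap R E.
have [k [k0 hk]] : exists k : nat, (0 < k)%N /\ b m m <= k%:R ^+ 2 * g.
  pose k := (Num.truncn (b m m / g)).+1; exists k; split => //.
  have : b m m / g < k%:R by exact: truncnS_gt.
  rewrite ltr_pdivrMr // => /ltW /le_trans; apply.
  by apply: ler_wpM2r; [exact: ltW | rewrite ler_eXnr // ler1n].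
have k0' : 0 < k%:R :> R by rewrite ltr0n.
exists (2 * k%:R)^-1; first by rewrite invr_gt0 mulr_gt0.
move=> a l ha l0; have gl := hg l l0.
have bMnr x y j : b x (y *+ j) = j%:R * b x y by rewrite bC mw_pairingMnl bC.
have bNr x y : b x (- y) = - b x y by rewrite bC mw_pairingNl bC.
have bound : `|b m l| <= k%:R * b l l.
  have q l' : b l' l' = b l l -> - (2 * b m l') <= 2 * (k%:R * b l l).
    move=> e; have := mw_pairing_ge0 R (m + l' *+ k).
    rewrite bD [b m (_ + _)]bC [b (l' *+ k) (_ + _)]bC !bD !mw_pairingMnl !bMnr e.
    rewrite [b l' m]bC => p.
    have : k%:R * (- (2 * b m l')) <= k%:R * (2 * (k%:R * b l l)).
      have : k%:R ^+ 2 * g <= k%:R ^+ 2 * b l l by rewrite ler_wpM2l ?exprn_ge0.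
      rewrite !expr2 in hk *; lra.
    by rewrite ler_pM2l.
  rewrite ler_norml; have := q l erefl; have := q (- l).
  rewrite !bNr mw_pairingNl opprK => /(_ erefl).
  move=> *; apply/andP; split; lra.
have l00 : 0 <= b l l by exact: mw_pairing_ge0.
have : `|2 * a * b m l| <= b l l.
  rewrite (normrM (2 * a)) (normrM 2) (ger0_norm (ler0n _ 2)).
  have h2 : `|a| * `|b m l| <= (2 * k%:R)^-1 * (k%:R * b l l) by exact: ler_pM.
  rewrite -mulrA; apply: le_trans (ler_wpM2l (ler0n R 2) h2) _.
  by rewrite le_eqVlt; apply/orP; left; apply/eqP; field; rewrite gt_eqF.
by rewrite ler_norml => /andP[]; lra.
Qed.

(** The lifts of the two points differ by (s - t) m + l with l in the lattice; for
    |s - t| small, l = 0 gives the shortest difference. *)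
Lemma geodesic_dist_local m : exists2 d : R, 0 < d & forall s t, `|s - t| <= d ->
  torus_dist (closed_geodesic m s) (closed_geodesic m t) = `|s - t| * lattice_norm m.
Proof.
have [d d0 hd] := mw_pairing_segment_ge m; exists d => // s t hst.
apply/eqP; rewrite eq_le geodesic_dist_le /=; apply: torus_dist_lb => v w.
move=> /height_torus_eqP[l1 ->] /height_torus_eqP[l2 ->].
have -> : s *: tensor_of R m + tensor_of R l1 - (t *: tensor_of R m + tensor_of R l2)
    = (s - t) *: tensor_of R m + tensor_of R (l1 - l2) :> HS.
  by rewrite raddfB scalerBl /= opprD addrACA.
set l := l1 - l2; have [->|l0] := eqVneq l 0.
  by rewrite raddf0 addr0 norm_scale_of.
rewrite -norm_scale_of /height_norm ler_wsqrtr //.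
rewrite inner_segment inner_scale_of; have := hd _ _ hst l0; lra.
Qed.

Lemma itv_partition_sum (s : seq R) : itv_partition 0 1 s ->
  \sum_(0 <= i < size s) `|nth 1 (0 :: s) i - nth 1 (0 :: s) i.+1| = 1.
Proof.
move=> hs; have [/(pathP 1) lt_s _] := hs.
rewrite (eq_big_nat _ _ (F2 := fun i => nth 1 (0 :: s) i.+1 - nth 1 (0 :: s) i)).
  by rewrite telescope_sumr // (itv_partition_nth_size _ hs) /= subr0.
move=> i /andP[_ hi]; rewrite distrC gtr0_norm // subr_gt0; exact: lt_s.
Qed.

Lemma fine_partition (d : R) : 0 < d -> exists2 s : seq R, itv_partition 0 1 s &
  forall i, (i < size s)%N -> `|nth 1 (0 :: s) i - nth 1 (0 :: s) i.+1| <= d.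
Proof.
move=> d0; pose n := (Num.truncn d^-1).+1.
have n0 : 0 < n%:R :> R by rewrite ltr0n.
have nd : n%:R^-1 <= d.
  rewrite invf_ple ?posrE //; apply: ltW; exact: truncnS_gt.
pose s : seq R := [seq k.+1%:R / n%:R | k <- iota 0 n].
have szs : size s = n by rewrite size_map size_iota.
have nthE i : (i <= n)%N -> nth 1 (0 :: s) i = i%:R / n%:R.
  case: i => [|i] hi /=; first by rewrite mul0r.
  by rewrite (nth_map 0%N) ?size_iota // nth_iota // add0n.
have step i : nth 1 (0 :: s) i.+1 = nth 1 s i by [].
exists s => [|i].
  split.
    apply/(pathP 1) => i; rewrite szs => hi.
    by rewrite -step !nthE ?(ltnW hi) // ltr_pM2r ?invr_gt0 // ltr_nat.
  have <- : nth 1 (0 :: s) n = last 0 s by rewrite -szs nth_last.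
  by rewrite nthE // divff // gt_eqF.
rewrite szs => hi; rewrite !nthE ?(ltnW hi) // distrC -mulrBl -natrB // subSnn mul1r.
by rewrite ger0_norm // invr_ge0 ltW.
Qed.

(** Every polygonal length is at most the norm of m by the upper bound on distances,
    and a partition finer than the scale of [geodesic_dist_local] attains it. *)
Lemma geodesic_lengthE m : geodesic_length R m = (lattice_norm m)%:E.
Proof.
apply/eqP; rewrite eq_le; apply/andP; split.
  apply: ge_ereal_sup => _ [s hs <-]; rewrite lee_fin.
  apply: le_trans (ler_sum _ (fun i _ => geodesic_dist_le _ _ _)) _.
  by rewrite -mulr_suml itv_partition_sum // mul1r.
have [d d0 hd] := geodesic_dist_local m; have [s hs hsd] := fine_partition d0.
apply: ereal_sup_ubound; exists s => //; congr (_%:E).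
transitivity (\sum_(0 <= i < size s)
    `|nth 1 (0 :: s) i - nth 1 (0 :: s) i.+1| * lattice_norm m).
  by apply: eq_big_nat => i /andP[_ hi]; apply: hd; exact: hsd.
by rewrite -mulr_suml itv_partition_sum // mul1r.
Qed.

Lemma geodesic_length_sqr m : (geodesic_length R m ^+ 2)%E = (b m m)%:E.
Proof. by rewrite geodesic_lengthE -EFin_expe sqr_sqrtr // mw_pairing_ge0. Qed.
End Torus.

(** * Transport along an isomorphism of lattices *)

Lemma morphD_sumMz (U V : zmodType) (f : U -> V) (I : finType) (P : I -> U) (c : I -> int) :
  {morph f : x y / x + y} -> f (\sum_i P i *~ c i) = \sum_i f (P i) *~ c i.
Proof.
move=> fD; have f0 : f 0 = 0 by apply: (@addIr _ (f 0)); rewrite -fD !add0r.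
pose F : {additive U -> V} := HB.pack f (GRing.isNmodMorphism.Build U V f (conj f0 fD)).
by rewrite -[f]/(F : U -> V) raddf_sum; apply: eq_bigr => i _; rewrite raddfMz.
Qed.

Lemma basis_iso (M M' : zmodType) r (P : 'I_r -> M) (P' : 'I_r -> M') :
  is_basis P -> is_basis P' -> exists2 f : M -> M', {morph f : x y / x + y} &
  forall c : {ffun 'I_r -> int}, f (\sum_i P i *~ c i) = \sum_i P' i *~ c i.
Proof.
move=> bP bP'; pose c m : {ffun 'I_r -> int} := sval (cid (bP m)).
have cE m : m = \sum_i P i *~ c m i by rewrite /c; case: cid => x [].
have cU m (d : {ffun 'I_r -> int}) : m = \sum_i P i *~ d i -> d = c m.
  by rewrite /c; case: cid => x /= [_ h] e; rewrite (h d e).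
exists (fun m => \sum_i P' i *~ c m i) => [m n|d]; last first.
  by rewrite -(cU (\sum_i P i *~ d i) d).
have -> : c (m + n) = [ffun i => c m i + c n i].
  apply/esym/cU; rewrite {1}(cE m) {1}(cE n) -big_split.
  by apply: eq_bigr => i _; rewrite ffunE mulrzDr.
by rewrite -big_split; apply: eq_bigr => i _; rewrite ffunE mulrzDr.
Qed.

Section Isometry.
Variables (R : realType) (E E' : ellcurve rat).
Local Notation MW := (mordell_weil E).
Local Notation MW' := (mordell_weil E').
Variables (f : MW -> MW') (g : MW' -> MW).
Hypothesis fD : {morph f : x y / x + y}.
Hypothesis gD : {morph g : x y / x + y}.
Hypotheses (fK : cancel f g) (gK : cancel g f).
Hypothesis fb : forall m n, mw_pairing R (f m) (f n) = mw_pairing R m n.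

Lemma is_basis_iso r (Q : 'I_r -> MW) : is_basis Q -> is_basis (f \o Q).
Proof.
move=> bQ m'; have [c [cE cU]] := bQ (g m').
exists c; split=> [|d dE]; first by rewrite /= -(morphD_sumMz _ _ fD) -cE gK.
by apply: cU; rewrite dE (morphD_sumMz _ _ gD); apply: eq_bigr => i _; rewrite /= fK.
Qed.

(** Bases correspond to each other under the isomorphism, with the same Gram matrix,
    so the sets of determinants that define the two regulators coincide. *)
Lemma regulators_sub :
  [set d : R | exists r (P : 'I_r -> MW), is_basis P /\ d = \det (gram R P)] `<=`
  [set d : R | exists r (P : 'I_r -> MW'), is_basis P /\ d = \det (gram R P)].
Proof.
move=> d [r [Q [bQ ->]]]; exists r, (f \o Q); split; first exact: is_basis_iso.
by congr (\det _); apply/matrixP => i j; rewrite !mxE /= fb.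
Qed.

End Isometry.

Section TorusMap.
Variables (R : realType) (E E' : ellcurve rat).
Local Notation MW := (mordell_weil E).
Local Notation MW' := (mordell_weil E').
Variables (f : MW -> MW').
Hypothesis fD : {morph f : x y / x + y}.
Hypothesis fb : forall m n, mw_pairing R (f m) (f n) = mw_pairing R m n.

Definition space_map : height_space R E -> height_space R E' :=
  tensor_lift (fun m => tensor_of R (f m)).
Local Notation T := space_map.

Let tfD : {morph (fun m => tensor_of R (f m)) : m n / m + n}.
Proof. by move=> m n; rewrite fD raddfD. Qed.

Lemma space_mapD : {morph T : v w / v + w}. Proof. exact: tensor_liftD tfD. Qed.
Lemma space_mapZ a v : T (a *: v) = a *: T v. Proof. exact: tensor_liftZ tfD a v. Qed.
Lemma space_map_of m : T (tensor_of R m) = tensor_of R (f m).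
Proof. exact: tensor_lift_of tfD m. Qed.

Lemma space_mapB v w : T (v - w) = T v - T w.
Proof. by rewrite space_mapD -scaleN1r space_mapZ scaleN1r. Qed.

Lemma space_map_inner v w : height_inner (T v) (T w) = height_inner v w.
Proof.
have bC := @mw_pairingC R E; have bD := @mw_pairingDl R E.
have bC' := @mw_pairingC R E'; have bD' := @mw_pairingDl R E'.
rewrite /height_inner; elim/tensor_ind: v => [v v' hv hv'|a v hv|m].
- by rewrite space_mapD (tensor_formDl bD') (tensor_formDl bD) hv hv'.
- by rewrite space_mapZ (tensor_formZl bD') (tensor_formZl bD) hv.
elim/tensor_ind: w => [w w' hw hw'|a w hw|n].
- by rewrite space_mapD (tensor_formDr bC' bD') (tensor_formDr bC bD) hw hw'.
- by rewrite space_mapZ (tensor_formZr bC' bD') (tensor_formZr bC bD) hw.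
- by rewrite !space_map_of (tensor_form_of bC' bD') (tensor_form_of bC bD) fb.
Qed.

Definition torus_map (x : height_torus R E) : height_torus R E' :=
  \pi_(height_torus R E') (T (repr x)).

Lemma torus_map_pi v : torus_map (\pi_(height_torus R E) v) = \pi_(height_torus R E') (T v).
Proof.
apply/height_torus_eqP; have /height_torus_eqP[l ->] := reprK (\pi_(height_torus R E) v).
by exists (f l); rewrite space_mapD space_map_of.
Qed.

(** Applied to an isomorphism and to its inverse, this shows that the same set of norms
    defines the distance on both tori. *)
Lemma torus_dist_sub (x y : height_torus R E) :
  [set d | exists v w : height_space R E,
    [/\ \pi_(height_torus R E) v = x, \pi_(height_torus R E) w = y & d = height_norm (v - w)]] `<=`
  [set d | exists v w : height_space R E',
    [/\ \pi_(height_torus R E') v = torus_map x, \pi_(height_torus R E') w = torus_map y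
      & d = height_norm (v - w)]].
Proof.
move=> _ [v [w [<- <- ->]]]; exists (T v), (T w); rewrite !torus_map_pi; split=> //.
by rewrite -space_mapB /height_norm space_map_inner.
Qed.
End TorusMap.

Section InverseMaps.
Variables (R : realType) (E E' : ellcurve rat).
Variables (f : mordell_weil E -> mordell_weil E') (g : mordell_weil E' -> mordell_weil E).
Hypothesis fD : {morph f : x y / x + y}.
Hypothesis gD : {morph g : x y / x + y}.
Hypothesis fK : cancel f g.

Lemma space_mapK : cancel (@space_map R E E' f) (@space_map R E' E g).
Proof.
elim/tensor_ind => [v w hv hw|a v hv|m].
- by rewrite !space_mapD // hv hw.
- by rewrite !space_mapZ // hv.
- by rewrite !space_map_of // fK.
Qed.

Lemma torus_mapK : cancel (@torus_map R E E' f) (@torus_map R E' E g).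
Proof.
by move=> x; rewrite -[x]reprK (torus_map_pi fD) (torus_map_pi gD) space_mapK.
Qed.
End InverseMaps.

Lemma mw_pairing_polarization (R : realType) (F : ellcurve rat) (m n : mordell_weil F) :
  mw_pairing R m n =
    2^-1 * (mw_pairing R (m + n) (m + n) - mw_pairing R m m - mw_pairing R n n).
Proof.
by rewrite mw_pairingDl !(mw_pairingC _ _ (m + n)) !mw_pairingDl (mw_pairingC _ n m); field.
Qed.

Lemma isometric_tori_iso (R : realType) (E E' : ellcurve rat)
  (f : mordell_weil E -> mordell_weil E') (g : mordell_weil E' -> mordell_weil E) :
  {morph f : x y / x + y} -> {morph g : x y / x + y} -> cancel f g -> cancel g f ->
  (forall m n, mw_pairing R (f m) (f n) = mw_pairing R m n) ->
  regulator R E = regulator R E' /\ isometric_tori R E E'.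
Proof.
move=> fD gD fK gK fb.
have gb m n : mw_pairing R (g m) (g n) = mw_pairing R m n by rewrite -fb !gK.
split.
  congr (get _); apply/seteqP; split; first exact: regulators_sub fD gD fK gK fb.
  exact: regulators_sub gD fD gK fK gb.
exists (torus_map f).
  by exists (torus_map g); exact: torus_mapK.
move=> x y; congr (inf _); apply/seteqP; split; last exact: (torus_dist_sub fD fb).
have := torus_dist_sub gD gb (x := torus_map f x) (y := torus_map f y).
rewrite (torus_mapK fD gD fK x) (torus_mapK fD gD fK y); exact.
Qed.

Lemma iso_of_gram (R : realType) (E E' : ellcurve rat) r (P : 'I_r -> mordell_weil E)
    (P' : 'I_r -> mordell_weil E') : is_basis P -> is_basis P' ->
  (forall i j, mw_pairing R (P i) (P j) = mw_pairing R (P' i) (P' j)) ->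
  regulator R E = regulator R E' /\ isometric_tori R E E'.
Proof.
move=> bP bP' eb; have [f fD fE] := basis_iso bP bP'; have [g gD gE] := basis_iso bP' bP.
have bsum F (Q : 'I_r -> mordell_weil F) (c d : {ffun 'I_r -> int}) :
    mw_pairing R (\sum_i Q i *~ c i) (\sum_j Q j *~ d j) =
    \sum_i (\sum_j mw_pairing R (Q i) (Q j) *~ d j) *~ c i.
  rewrite (morphD_sumMz (f := fun m => mw_pairing R m _)); last first.
    by move=> m n; exact: mw_pairingDl.
  apply: eq_bigr => i _; congr (_ *~ _); apply: morphD_sumMz => m n.
  by rewrite !(mw_pairingC _ (Q i)) mw_pairingDl.
apply: (isometric_tori_iso fD gD).
- by move=> m; have [c [-> _]] := bP m; rewrite fE gE.
- by move=> m; have [c [-> _]] := bP' m; rewrite gE fE.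
- move=> m n; have [c [-> _]] := bP m; have [d [-> _]] := bP n.
  rewrite !fE !bsum; apply: eq_bigr => i _; congr (_ *~ _).
  by apply: eq_bigr => j _; rewrite eb.
Qed.

Local Open Scope ereal_scope.

Theorem theorem5p3 (R : realType) (E : ellcurve rat) (r : nat)
    (P : 'I_r -> mordell_weil E) (basisP : is_basis P) :
  [/\ (forall i : 'I_r,
         (mw_pairing R (P i) (P i))%:E = geodesic_length R (P i) ^+ 2),
      (forall i j : 'I_r, (i < j)%N ->
         (mw_pairing R (P i) (P j))%:E =
           (2^-1)%:E * (geodesic_length R (P i + P j)%R ^+ 2
                        - geodesic_length R (P i) ^+ 2
                        - geodesic_length R (P j) ^+ 2)) &
      (forall (E' : ellcurve rat) (P' : 'I_r -> mordell_weil E'),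
         is_basis P' ->
         (forall i : 'I_r,
            geodesic_length R (P i) ^+ 2 = geodesic_length R (P' i) ^+ 2) ->
         (forall i j : 'I_r, (i < j)%N ->
            geodesic_length R (P i + P j)%R ^+ 2 =
            geodesic_length R (P' i + P' j)%R ^+ 2) ->
         [/\ gram R P = gram R P',
             regulator R E = regulator R E' &
             isometric_tori R E E'])].
Proof.
split=> [i|i j _|E' P' basisP' eq_diag eq_off].
- by rewrite geodesic_length_sqr.
- rewrite !geodesic_length_sqr -!EFinB -EFinM; congr (_%:E).
  exact: mw_pairing_polarization.
have eq_norm (m : mordell_weil E) (m' : mordell_weil E') :
    geodesic_length R m ^+ 2 = geodesic_length R m' ^+ 2 ->
    mw_pairing R m m = mw_pairing R m' m'.
  by rewrite !geodesic_length_sqr; exact: EFin_inj.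
have eq_lt (i j : 'I_r) : (i < j)%N -> mw_pairing R (P i) (P j) = mw_pairing R (P' i) (P' j).
  move=> ij; have := eq_norm _ _ (eq_off i j ij).
  have := eq_norm _ _ (eq_diag i); have := eq_norm _ _ (eq_diag j).
  have := mw_pairing_polarization R (P' i) (P' j).
  have := mw_pairing_polarization R (P i) (P j).
  by move=> -> -> -> -> ->.
have eq_gram (i j : 'I_r) : mw_pairing R (P i) (P j) = mw_pairing R (P' i) (P' j).
  case: (ltngtP i j) => [/eq_lt //|/eq_lt ji|/val_inj <-].
    by rewrite mw_pairingC ji mw_pairingC.
  exact: eq_norm (eq_diag i).
have [eq_reg iso] := iso_of_gram basisP basisP' eq_gram.
by split=> //; apply/matrixP => i j; rewrite !mxE.
Qed.
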